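(* Let $\alpha>0$ and $(a,b)\in\mathbb{R}^2$ with $a<b$. If $f\in S_b^\alpha(L^\infty)$ and $g\in S_a^\alpha(L^1)$, then $$\int_a^b f(x)\left(\mathcal{D}_a^\alpha g\right)(x)\,dx=-\int_a^b \left(\mathcal{D}_b^\alpha f\right)(x)g(x)\,dx.$$
   Context: Let $E_1(x)=\int_x^\infty \frac{e^{-t}}{t}\,dt$ for $x>0$ and $\mathcal{S}(t)=e^{-t}\int_0^\infty \frac{t^{s-1}}{\Gamma(s)}\,ds$ for $t>0$, where $\Gamma$ is the Gamma function. For $\alpha>0$ and $f\in L^1([a,b];\mathbb{R})$, define for a.e. $x\in[a,b]$ $$(J_a^\alpha f)(x)=\frac{1}{\alpha}\int_a^x E_1\left(\frac{x-t}{\alpha}\right)f(t)\,dt,\qquad (J_b^\alpha f)(x)=\frac{1}{\alpha}\int_x^b E_1\left(\frac{t-x}{\alpha}\right)f(t)\,dt,$$ $$(S_a^\alpha f)(x)=\int_a^x \mathcal{S}\left(\frac{x-t}{\alpha}\right)f(t)\,dt,\qquad (S_b^\alpha f)(x)=\int_x^b \mathcal{S}\left(\frac{t-x}{\alpha}\right)f(t)\,dt.$$ A function in $L^1([a,b];\mathbb{R})$ has an absolutely continuous representative if it coincides a.e. on $[a,b]$ with an absolutely continuous function on $[a,b]$; it is then identified with that function. If $J_a^\alpha f$ (respectively $J_b^\alpha f$) has an absolutely continuous representative, the left-sided (respectively right-sided) fractional derivative of order $\alpha$ of $f$ is $(\mathcal{D}_a^\alpha f)(x)=\frac{d}{dx}(J_a^\alpha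 f)(x)$ (respectively $(\mathcal{D}_b^\alpha f)(x)=\frac{d}{dx}(J_b^\alpha f)(x)$) for a.e. $x\in[a,b]$. For $1\leq p\leq\infty$, $S_a^\alpha(L^p)=\{S_a^\alpha\varphi:\ \varphi\in L^p([a,b];\mathbb{R})\}$ and $S_b^\alpha(L^p)=\{S_b^\alpha\varphi:\ \varphi\in L^p([a,b];\mathbb{R})\}$. *)

(* Defs.v *)
From HB Require Import structures.
From mathcomp Require Import all_boot all_order all_algebra.
From mathcomp Require Import all_classical all_reals all_analysis.

Set Implicit Arguments.
Unset Strict Implicit.
Unset Printing Implicit Defensive.
Import Order.TTheory GRing.Theory Num.Theory.
Import numFieldNormedType.Exports.

Local Open Scope classical_set_scope.
Local Open Scope ring_scope.

(* Functions on [a, b] are represented by functions R -> R whose values outside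
   [a, b] are irrelevant.  The library's [lebesgue_measure] lives on the Borel
   sigma-algebra, so a class modulo a.e. equality is handled through its Borel
   representatives; every Lebesgue class has one. *)

Section definitions.
Context {R : realType}.
Local Notation mu := (@lebesgue_measure R).
Implicit Types (alpha a b x t s : R) (p : \bar R) (f d F : R -> R).

(* Used for x > 0 only. *)
Definition expint1 x : R := \int[mu]_(t in `[x, +oo[) (expR (- t) / t).

Definition Gamma s : R :=
  \int[mu]_(t in `]0, +oo[) (t `^ (s - 1) * expR (- t)).

(* Used for t > 0 only. *)
Definition Skernel t : R :=
  expR (- t) * \int[mu]_(s in `]0, +oo[) (t `^ (s - 1) / Gamma s).

(* L^p([a, b]), for 1 <= p <= +oo: the extension by 0 lies in L^p(R). *)
Definition Lp_itv a b p : set (R -> R) :=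
  [set f | f \_ `[a, b] \in Lfun mu p].

(* In the four operators the kernel takes a junk value at the single point
   t = x, and the integral takes a junk value at those x, a null set, for which
   the integrand is not integrable. *)
Definition Jleft alpha a f x : R :=
  alpha^-1 * \int[mu]_(t in `[a, x]) (expint1 ((x - t) / alpha) * f t).

Definition Jright alpha b f x : R :=
  alpha^-1 * \int[mu]_(t in `[x, b]) (expint1 ((t - x) / alpha) * f t).

Definition Sleft alpha a f x : R :=
  \int[mu]_(t in `[a, x]) (Skernel ((x - t) / alpha) * f t).

Definition Sright alpha b f x : R :=
  \int[mu]_(t in `[x, b]) (Skernel ((t - x) / alpha) * f t).

Definition abs_continuous a b F : Prop :=
  forall e : R, 0 < e -> exists2 delta : R, 0 < delta &
    forall (n : nat) (u v : 'I_n -> R),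
      (forall i, a <= u i <= v i /\ v i <= b) ->
      trivIset setT (fun i => [set` `]u i, v i[]) ->
      \sum_(i < n) (v i - u i) < delta ->
      \sum_(i < n) `|F (v i) - F (u i)| < e.

(* d is (a representative of) the a.e. derivative on [a, b] of the absolutely
   continuous representative of h; that representative is unique on [a, b], so
   d is determined up to a.e. equality. *)
Definition is_ac_derivative a b (h d : R -> R) : Prop :=
  measurable_fun `[a, b] d /\
  exists F : R -> R,
    [/\ abs_continuous a b F,
        F = h %[ae mu in [set` `[a, b]]] &
        \forall x \ae mu, x \in `[a, b] -> is_derive x (1 : R) F (d x)].

Definition is_left_fracderiv alpha a b f d : Prop :=
  Lp_itv a b 1%E f /\ is_ac_derivative a b (Jleft alpha a f) d.

Definition is_right_fracderiv alpha a b f d : Prop :=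
  Lp_itv a b 1%E f /\ is_ac_derivative a b (Jright alpha b f) d.

Definition Sleft_space alpha a b p : set (R -> R) :=
  [set f | measurable_fun `[a, b] f /\
    exists2 phi, Lp_itv a b p phi & f = Sleft alpha a phi %[ae mu in [set` `[a, b]]]].

Definition Sright_space alpha a b p : set (R -> R) :=
  [set f | measurable_fun `[a, b] f /\
    exists2 phi, Lp_itv a b p phi & f = Sright alpha b phi %[ae mu in [set` `[a, b]]]].

End definitions.

(* Main.v *)
Require Import Defs.
From HB Require Import structures.
From mathcomp Require Import all_boot all_order all_algebra.
From mathcomp Require Import all_classical all_reals all_analysis.
From mathcomp Require Import measurable_realfun ess_sup_inf.
From mathcomp Require Import ring lra.

(* The kernels E_1 and S form a Sonine pair: E_1 * S is the Heaviside function.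
   Let g_s(t) = t^(s-1) e^-t / Gamma(s) on t > 0, so that g_r * g_s = g_(r+s)
   and S is the integral of g_s over s > 0.  If H_r(x) is the integral of
   u^(r-1) e^-u over u > x, then H_r * S = Gamma(r) int_0^r (1 * g_s) ds by the
   semigroup law, which tends to 1 as r -> 0, while H_r tends to H_0 = E_1.
   Hence J_a (S_a phi) is the primitive of phi and J_b (S_b psi) the reversed
   primitive of psi, so the fractional derivatives of g = S_a phi and
   f = S_b psi are phi and - psi.  The identity becomes
   int (S_b psi) phi = int psi (S_a phi), which is Tonelli's theorem applied to
   the positive and negative parts of phi and psi. *)

Set Implicit Arguments.
Unset Strict Implicit.
Unset Printing Implicit Defensive.
Import Order.TTheory GRing.Theory Num.Theory.
Import numFieldNormedType.Exports.

Local Open Scope classical_set_scope.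
Local Open Scope ring_scope.

(** * Convolution of nonnegative functions *)

(** All convolutions are taken over R with values in [0, +oo], where Tonelli's theorem and
    additivity hold without integrability conditions; real numbers come back through [fine], once
    finiteness is known. For r > 0, H_r is Gamma(r) minus the convolution of 1 with the unnormalised
    density, and the semigroup law applies to that convolution. At r = 0 the difference reads oo -
    oo, so r stays positive and the limit is taken on inequalities. The lower bound uses H_r <= E_1
    + r on x > 0. The upper bound first restricts E_1 to x >= d, where H_r >= d^r E_1: near 0, E_1
    is unbounded while H_r is not. Monotone convergence removes the cutoff. Since E_1 * S is
    bounded, J_a S_a phi is computed at every point of [a, b], although S_a phi is known only a.e. A
    fractional derivative is given through some absolutely continuous representative, so a
    uniqueness argument must precede its replacement by phi or - psi. *)

Section affine_change_of_variable.
Context {R : realType}.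
Local Notation mu := (@lebesgue_measure R).
Local Open Scope ereal_scope.

Let affine (c d : R) : measurableTypeR R -> measurableTypeR R :=
  fun x => (c * x + d)%R.

Let measurable_affine (c d : R) : measurable_fun setT (affine c d).
Proof.
apply: measurable_funD; last exact: measurable_cst.
by apply: measurable_funM; [exact: measurable_cst|exact: measurable_id].
Qed.

(** Lebesgue measure is [|c|] times its image under the affine map; by uniqueness it suffices to
    compare lengths on the intervals []a, b]], whose preimages are again intervals. *)
Lemma ge0_integral_affine (c d : R) (f : R -> \bar R) :
  c != 0%R -> measurable_fun setT f -> (forall x, 0 <= f x) ->
  \int[mu]_x f (c * x + d)%R = `|c^-1|%:E * \int[mu]_x f x.
Proof.
move=> c0 mf f0.
pose phi := affine c d.
have mphi : measurable_fun setT phi := measurable_affine c d.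
pose m :=
  measure_function_pushforward__canonical__measure_function_Measure mu mphi.
have nc0 : (0 < `|c|)%R by rewrite normr_gt0.
have H : forall A, measurable A ->
    mu A = mscale (NngNum (normr_ge0 c)) m A.
  apply: (@lebesgue_measure_unique R (mscale _ m)) => //= _ [[a b]] _ <-.
  rewrite /mscale/= /pushforward.
  have [c_gt0|c_lt0|] := ltgtP 0%R c; last by move=> e; rewrite -e eqxx in c0.
    have -> : affine c d @^-1` `]a, b] = `]((a - d) / c)%R, ((b - d) / c)%R]%classic.
      apply/seteqP; split => x /=; rewrite !in_itv/= /affine.
        by rewrite ltr_pdivrMr// ler_pdivlMr// ltrBlDr lerBrDr mulrC.
      by rewrite ltr_pdivrMr// ler_pdivlMr// ltrBlDr lerBrDr mulrC.
    rewrite !lebesgue_measure_itv/= !lte_fin ltr_pM2r ?invr_gt0// ltrD2r.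
    case: ifPn => _; last by rewrite mule0.
    by rewrite -!EFinD -EFinM gtr0_norm//; congr EFin; field.
  have -> : affine c d @^-1` `]a, b] = `[((b - d) / c)%R, ((a - d) / c)%R[%classic.
    apply/seteqP; split => x /=; rewrite !in_itv/= /affine.
      by rewrite ltr_ndivlMr// ler_ndivrMr// ltrBlDr lerBrDr mulrC andbC.
    by rewrite ltr_ndivlMr// ler_ndivrMr// ltrBlDr lerBrDr mulrC andbC.
  rewrite !lebesgue_measure_itv/= !lte_fin ltr_nM2r ?invr_lt0// ltrD2r.
  case: ifPn => _; last by rewrite mule0.
  by rewrite -!EFinD -EFinM ltr0_norm//; congr EFin; field.
have -> : \int[mu]_x f x =
    \int[mscale (NngNum (normr_ge0 c)) m]_x f x.
  by apply: eq_measure_integral => A mA _; exact: H.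
rewrite ge0_integral_mscale//= ge0_integral_pushforward//.
rewrite preimage_setT muleA -EFinM normfV mulVf ?gt_eqF// mul1e.
by [].
Qed.

Lemma ge0_integral_shift (d : R) (f : R -> \bar R) :
  measurable_fun setT f -> (forall x, 0 <= f x) ->
  \int[mu]_x f (x + d)%R = \int[mu]_x f x.
Proof.
move=> mf f0; have := ge0_integral_affine d (oner_neq0 _) mf f0.
by under eq_integral do rewrite mul1r; rewrite invr1 normr1 mul1e.
Qed.

Lemma ge0_integral_reflect (d : R) (f : R -> \bar R) :
  measurable_fun setT f -> (forall x, 0 <= f x) ->
  \int[mu]_x f (d - x)%R = \int[mu]_x f x.
Proof.
move=> mf f0; have c0 : (-1 : R)%R != 0%R by rewrite oppr_eq0 oner_eq0.
have := ge0_integral_affine d c0 mf f0.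
rewrite invrN invr1 normrN normr1 mul1e => <-.
by apply: eq_integral => x _; rewrite mulN1r addrC.
Qed.

End affine_change_of_variable.

Section convolution.
Context {R : realType}.
Local Notation mu := (@lebesgue_measure R).
Local Open Scope ereal_scope.
Implicit Types f g h : R -> \bar R.

(** One-sided kernels are extended by 0 to the other half-line, so a single integral over R serves
    for all of them. *)
Definition conv f g (x : R) : \bar R := \int[mu]_y (f (x - y)%R * g y).

Let measurable_integrand f g (T := (R * R)%type) :
  measurable_fun setT f -> measurable_fun setT g ->
  measurable_fun setT (fun z : T => f (z.1 - z.2)%R * g z.2).
Proof.
move=> mf mg; apply: emeasurable_funM.
  by apply: (measurableT_comp mf); exact: measurable_funB.
exact: measurableT_comp mg _.
Qed.

Lemma conv_ge0 f g x : (forall y, 0 <= f y) -> (forall y, 0 <= g y) ->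
  0 <= conv f g x.
Proof. by move=> f0 g0; apply: integral_ge0 => y _; exact: mule_ge0. Qed.

Lemma measurable_conv_integrand f g (x : R) :
  measurable_fun setT f -> measurable_fun setT g ->
  measurable_fun setT (fun y : R => f (x - y)%R * g y).
Proof.
move=> mf mg; apply: emeasurable_funM => //.
by apply: (measurableT_comp mf); exact: measurable_funB.
Qed.

Lemma measurable_conv f g :
  measurable_fun setT f -> measurable_fun setT g ->
  (forall y, 0 <= f y) -> (forall y, 0 <= g y) ->
  measurable_fun setT (conv f g).
Proof.
move=> mf mg f0 g0.
have := @measurable_fun_fubini_tonelli_F _ _ _ _ R mu
  (fun z : R * R => f (z.1 - z.2)%R * g z.2)
  (measurable_integrand mf mg) _.
by apply => z; exact: mule_ge0.
Qed.

Lemma convC f g :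
  measurable_fun setT f -> measurable_fun setT g ->
  (forall y, 0 <= f y) -> (forall y, 0 <= g y) ->
  conv f g = conv g f.
Proof.
move=> mf mg f0 g0; apply/funext => x.
rewrite /conv -(@ge0_integral_reflect _ x (fun y => g (x - y)%R * f y)).
- by apply: eq_integral => y _; rewrite subKr muleC.
- exact: measurable_conv_integrand.
- by move=> y; exact: mule_ge0.
Qed.

(** Tonelli's theorem, then a translation of the inner variable by z. *)
Lemma convA f g h :
  measurable_fun setT f -> measurable_fun setT g -> measurable_fun setT h ->
  (forall y, 0 <= f y) -> (forall y, 0 <= g y) -> (forall y, 0 <= h y) ->
  conv f (conv g h) = conv (conv f g) h.
Proof.
move=> mf mg mh f0 g0 h0; apply/funext => x; rewrite /conv.
under eq_integral => y _.
  rewrite -ge0_integralZl//; last 2 first.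
  - exact: measurable_conv_integrand.
  - by move=> z _; exact: mule_ge0.
  over.
rewrite (@fubini_tonelli _ _ _ _ R mu mu
  (fun p => f (x - p.1)%R * (g (p.1 - p.2)%R * h p.2)))/=; last 2 first.
- apply: emeasurable_funM; last exact: measurable_integrand.
  by apply: (measurableT_comp mf); exact: measurable_funB.
- by move=> p; rewrite !mule_ge0.
apply: eq_integral => z _.
under eq_integral do rewrite muleA.
rewrite ge0_integralZr//; last 2 first.
- apply: emeasurable_funM.
    by apply: (measurableT_comp mf); exact: measurable_funB.
  by apply: (measurableT_comp mg); exact: measurable_funB.
- by move=> y _; exact: mule_ge0.
congr (_ * _).
rewrite -(@ge0_integral_shift _ z (fun y => f (x - y)%R * g (y - z)%R)).
- apply: eq_integral => y _; rewrite addrK; congr (f _ * _); ring.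
- apply: emeasurable_funM.
    by apply: (measurableT_comp mf); exact: measurable_funB.
  by apply: (measurableT_comp mg); exact: measurable_funB.
- by move=> y; exact: mule_ge0.
Qed.

Lemma le_conv f g g' x :
  measurable_fun setT f -> measurable_fun setT g -> measurable_fun setT g' ->
  (forall y, 0 <= f y) -> (forall y, 0 <= g y) -> (forall y, g y <= g' y) ->
  conv f g x <= conv f g' x.
Proof.
move=> mf mg mg' f0 g0 gg'; apply: ge0_le_integral => //.
- by move=> y _; exact: mule_ge0.
- exact: measurable_conv_integrand.
- exact: measurable_conv_integrand.
- by move=> y _; exact: lee_wpmul2l.
Qed.

Lemma convD f g h (x : R) :
  measurable_fun setT f -> measurable_fun setT g -> measurable_fun setT h ->
  (forall y, 0 <= f y) -> (forall y, 0 <= g y) -> (forall y, 0 <= h y) ->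
  conv f (fun y => g y + h y) x = conv f g x + conv f h x.
Proof.
move=> mf mg mh f0 g0 h0; rewrite /conv.
rewrite -ge0_integralD//.
- by apply: eq_integral => y _; rewrite ge0_muleDr.
- by move=> y _; exact: mule_ge0.
- exact: measurable_conv_integrand.
- by move=> y _; exact: mule_ge0.
- exact: measurable_conv_integrand.
Qed.

Lemma convZ f g (c : \bar R) (x : R) :
  measurable_fun setT f -> measurable_fun setT g ->
  (forall y, 0 <= f y) -> (forall y, 0 <= g y) -> 0 <= c ->
  conv f (fun y => c * g y) x = c * conv f g x.
Proof.
move=> mf mg f0 g0 c0; rewrite /conv.
under eq_integral do rewrite muleCA.
rewrite ge0_integralZl//; first exact: measurable_conv_integrand.
by move=> y _; exact: mule_ge0.
Qed.

(** Phrased with sums only, since a difference of extended reals may be undefined. It will transport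
    the identity Gamma(r) = lower + upper incomplete gamma to convolutions. *)
Lemma conv_split f g h (k : \bar R) w (x : R) :
  measurable_fun setT f -> measurable_fun setT g -> measurable_fun setT h ->
  measurable_fun setT w ->
  (forall y, 0 <= f y) -> (forall y, 0 <= g y) -> (forall y, 0 <= h y) ->
  (forall y, 0 <= w y) -> 0 <= k -> (forall y, f y + g y = k * h y) ->
  conv f w x + conv g w x = k * conv h w x.
Proof.
move=> mf mg mh mw f0 g0 h0 w0 k0 fgh.
rewrite (convC mf)// (convC mg)// (convC mh)// -convD// -convZ//.
by congr (conv _ _ _); apply/funext.
Qed.

Lemma le_conv_comb f g h (k : \bar R) w (x : R) :
  measurable_fun setT f -> measurable_fun setT g -> measurable_fun setT h ->
  measurable_fun setT w ->
  (forall y, 0 <= f y) -> (forall y, 0 <= g y) -> (forall y, 0 <= h y) ->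
  (forall y, 0 <= w y) -> 0 <= k -> (forall y, f y <= g y + k * h y) ->
  conv f w x <= conv g w x + k * conv h w x.
Proof.
move=> mf mg mh mw f0 g0 h0 w0 k0 fgh.
have mkh : measurable_fun setT (fun y => k * h y) by exact: emeasurable_funM.
have kh0 y : 0 <= k * h y by exact: mule_ge0.
rewrite (convC mf)// (convC mg)// (convC mh)// -convZ// -convD//.
by apply: le_conv => //; exact: emeasurable_funD.
Qed.

Lemma le_convZ f g (k : \bar R) w (x : R) :
  measurable_fun setT f -> measurable_fun setT g -> measurable_fun setT w ->
  (forall y, 0 <= f y) -> (forall y, 0 <= g y) -> (forall y, 0 <= w y) ->
  0 <= k -> (forall y, k * f y <= g y) ->
  k * conv f w x <= conv g w x.
Proof.
move=> mf mg mw f0 g0 w0 k0 fg.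
have mkf : measurable_fun setT (fun y => k * f y) by exact: emeasurable_funM.
have kf0 y : 0 <= k * f y by exact: mule_ge0.
by rewrite (convC mf)// (convC mg)// -convZ//; exact: le_conv.
Qed.

Lemma measurable_section1 (k : R -> R -> \bar R) y :
  measurable_fun setT (fun p : R * R => k p.1 p.2) ->
  measurable_fun setT (k ^~ y).
Proof.
move=> mk; exact: (measurableT_comp mk (measurable_fun_pair
  (@measurable_id _ R setT) (measurable_cst y))).
Qed.

Lemma measurable_section2 (k : R -> R -> \bar R) x :
  measurable_fun setT (fun p : R * R => k p.1 p.2) ->
  measurable_fun setT (k x).
Proof.
move=> mk; exact: (measurableT_comp mk (measurable_fun_pair
  (measurable_cst x) (@measurable_id _ R setT))).
Qed.

Lemma measurable_swap (k : R -> R -> \bar R) :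
  measurable_fun setT (fun p : R * R => k p.1 p.2) ->
  measurable_fun setT (fun p : R * R => k p.2 p.1).
Proof.
move=> mk; exact: (measurableT_comp mk (measurable_fun_pair
  measurable_snd measurable_fst)).
Qed.

Lemma conv_integral f (k : R -> R -> \bar R) (x : R) :
  measurable_fun setT f -> measurable_fun setT (fun p : R * R => k p.1 p.2) ->
  (forall y, 0 <= f y) -> (forall s y, 0 <= k s y) ->
  conv f (fun y => \int[mu]_s k s y) x = \int[mu]_s conv f (k s) x.
Proof.
move=> mf mk f0 k0; rewrite /conv.
under eq_integral => y _.
  rewrite -ge0_integralZl//; last exact: measurable_section1.
  over.
rewrite (@fubini_tonelli _ _ _ _ R mu mu
  (fun p => f (x - p.1)%R * k p.2 p.1))//=.
- apply: emeasurable_funM; last exact: measurable_swap.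
  by apply: (measurableT_comp mf); exact: measurable_funB.
- by move=> p; exact: mule_ge0.
Qed.

End convolution.

(** * The gamma semigroup *)

Section gamma_kernels.
Context {R : realType}.
Local Notation mu := (@lebesgue_measure R).
Local Open Scope ereal_scope.
Implicit Types (s r t x : R).

Lemma measurable_if_ltr d (T : measurableType d) (u v : T -> R)
    (f : T -> \bar R) :
  measurable_fun setT u -> measurable_fun setT v -> measurable_fun setT f ->
  measurable_fun setT (fun z => if (u z < v z)%R then f z else 0).
Proof.
move=> mu_ mv mf; apply: measurable_fun_ifT => //; first exact: measurable_fun_ltr.
Qed.

Lemma measurable_if_ler d (T : measurableType d) (u v : T -> R)
    (f : T -> \bar R) :
  measurable_fun setT u -> measurable_fun setT v -> measurable_fun setT f ->
  measurable_fun setT (fun z => if (u z <= v z)%R then f z else 0).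
Proof.
move=> mu_ mv mf; apply: measurable_fun_ifT => //; first exact: measurable_fun_ler.
Qed.

Definition heaviside t : \bar R := if (0 < t)%R then 1 else 0.

Definition gamma_fun s t : \bar R :=
  if (0 < t)%R then (t `^ (s - 1) * expR (- t))%:E else 0.

Definition gamma_mass s : \bar R := \int[mu]_t gamma_fun s t.

(** Integrand of Euler's beta integral. Its value is never computed: it is eliminated between
    [conv_gamma_fun] and [gamma_massM]. *)
Definition beta_fun s r w : \bar R :=
  if (0 < w)%R then
    if (w < 1)%R then ((1 - w) `^ (s - 1) * w `^ (r - 1))%:E else 0
  else 0.

(** Model for the singularity of [gamma_fun r] at 0, with the explicit integral 1 / r. *)
Definition unit_powR r t : \bar R :=
  if (0 < t)%R then if (t <= 1)%R then (t `^ (r - 1))%:E else 0 else 0.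

Lemma heaviside_ge0 t : 0 <= heaviside t.
Proof. by rewrite /heaviside; case: ifP. Qed.

Lemma measurable_heaviside : measurable_fun setT heaviside.
Proof. exact: measurable_if_ltr. Qed.

Lemma gamma_fun_ge0 s t : 0 <= gamma_fun s t.
Proof.
by rewrite /gamma_fun; case: ifP => // _; rewrite lee_fin mulr_ge0 ?powR_ge0 ?expR_ge0.
Qed.

Lemma beta_fun_ge0 s r w : 0 <= beta_fun s r w.
Proof.
rewrite /beta_fun; case: ifP => // _; case: ifP => // _.
by rewrite lee_fin mulr_ge0 ?powR_ge0.
Qed.

Lemma unit_powR_ge0 r t : 0 <= unit_powR r t.
Proof.
by rewrite /unit_powR; case: ifP => // _; case: ifP => // _; rewrite lee_fin powR_ge0.
Qed.

Lemma gt0_powRE s t : (0 < t)%R -> (t `^ s = expR (s * ln t))%R.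
Proof. by move=> t0; rewrite /powR gt_eqF. Qed.

(** A power is jointly measurable in base and exponent once written as the exponential of a product,
    which is possible where t > 0. *)
Lemma measurable_gamma_fun2 :
  measurable_fun setT (fun p : R * R => gamma_fun p.1 p.2).
Proof.
rewrite [X in measurable_fun _ X](_ : _ = fun p : R * R =>
    if (0 < p.2)%R then (expR ((p.1 - 1) * ln p.2) * expR (- p.2))%:E else 0).
  apply: measurable_if_ltr => //.
  apply/measurable_EFinP; apply: measurable_funM.
    apply: measurableT_comp => //; apply: measurable_funM.
      exact: measurable_funB.
    exact: measurableT_comp.
  by apply: measurableT_comp => //; exact: measurableT_comp.
apply/funext => p; rewrite /gamma_fun; case: ifPn => // p0.
by rewrite gt0_powRE.
Qed.

Lemma measurable_gamma_fun s : measurable_fun setT (gamma_fun s).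
Proof. exact: (measurable_section2 _ measurable_gamma_fun2). Qed.

Lemma measurable_beta_fun s r : measurable_fun setT (beta_fun s r).
Proof.
apply: measurable_if_ltr => //; apply: measurable_if_ltr => //.
apply/measurable_EFinP; apply: measurable_funM; last exact: measurable_powR.
have mB : measurable_fun setT (fun w : R => 1 - w)%R by exact: measurable_funB.
exact: (measurableT_comp (measurable_powR (s - 1)) mB).
Qed.

Lemma measurable_unit_powR r : measurable_fun setT (unit_powR r).
Proof.
apply: measurable_if_ltr => //; apply: measurable_if_ler => //.
by apply/measurable_EFinP; exact: measurable_powR.
Qed.

Lemma integral_conv (f g : R -> \bar R) :
  measurable_fun setT f -> measurable_fun setT g ->
  (forall y, 0 <= f y) -> (forall y, 0 <= g y) ->
  \int[mu]_x conv f g x = (\int[mu]_x f x) * (\int[mu]_x g x).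
Proof.
move=> mf mg f0 g0; rewrite /conv.
have m2 : measurable_fun setT (fun p : R * R => f (p.1 - p.2)%R).
  by apply: (measurableT_comp mf); exact: measurable_funB.
rewrite (@fubini_tonelli _ _ _ _ R mu mu (fun p => f (p.1 - p.2)%R * g p.2))/=.
- under eq_integral => y _.
    rewrite ge0_integralZr//; last exact: (@measurable_section1 _ (fun a b => f (a - b)%R) y m2).
    rewrite (ge0_integral_shift (- y) mf f0).
    over.
  by rewrite ge0_integralZl// integral_ge0.
- by apply: emeasurable_funM => //; exact: measurableT_comp.
- by move=> p; exact: mule_ge0.
Qed.

(** The substitution y = x w extracts x^(s - 1) x^(r - 1) x = x^(s + r - 1), and the two
    exponentials multiply to e^-x whatever w is. *)
Lemma conv_gamma_fun s r :
  conv (gamma_fun s) (gamma_fun r) =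
  fun x => (\int[mu]_w beta_fun s r w) * gamma_fun (s + r) x.
Proof.
apply/funext => x; rewrite /conv.
have [x0|x0] := leP x 0%R.
  rewrite {3}/gamma_fun ltNge x0/= mule0 integral0_eq// => y _.
  rewrite /gamma_fun; have [y0|] := ltP 0%R y; last by rewrite mule0.
  by rewrite subr_gt0 ltNge (le_trans x0 (ltW y0)) mul0e.
have xn0 : x != 0%R by rewrite gt_eqF.
have := ge0_integral_affine 0 xn0
  (measurable_conv_integrand x (measurable_gamma_fun s) (measurable_gamma_fun r))
  (fun y => mule_ge0 (gamma_fun_ge0 s _) (gamma_fun_ge0 r y)).
rewrite gtr0_norm ?invr_gt0// => /(congr1 (mule x%:E)).
rewrite muleA -EFinM divff// mul1e => <-.
have -> : gamma_fun (s + r) x = x%:E * (x `^ (s - 1) * x `^ (r - 1) * expR (- x))%R%:E.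
  rewrite /gamma_fun x0 -EFinM; congr EFin.
  rewrite mulrA; congr (_ * _)%R.
  rewrite -[X in (X * _)%R](powRr1 (ltW x0)) -!powRD ?xn0 ?implybT//.
  by congr (_ `^ _)%R; ring.
rewrite [RHS]muleC -muleA; congr (_ * _); rewrite -ge0_integralZl//.
- apply: eq_integral => w _; rewrite addr0 /gamma_fun /beta_fun.
  have -> : (x - x * w = x * (1 - w))%R by ring.
  rewrite !pmulr_rgt0// subr_gt0.
  have [w0|w0] := ltP 0%R w; last by rewrite !mule0.
  have [w1|w1] := ltP w 1%R; last by rewrite mul0e mule0.
  rewrite -!EFinM; congr EFin.
  rewrite powRM ?(ltW x0) ?subr_ge0 ?(ltW w1)// powRM ?(ltW x0) ?(ltW w0)//.
  have -> : expR (- x) = (expR (- (x * (1 - w))) * expR (- (x * w)))%R.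
    by rewrite -expRD; congr expR; ring.
  by ring.
- exact: measurable_beta_fun.
- by move=> w _; exact: beta_fun_ge0.
- by rewrite lee_fin !mulr_ge0 ?powR_ge0 ?expR_ge0.
Qed.

End gamma_kernels.

Section unit_power_integral.
Context {R : realType}.
Local Notation mu := (@lebesgue_measure R).
Implicit Types (s r t x : R).

Lemma integral_unit_powR r : (0 < r)%R ->
  (\int[mu]_t unit_powR r t)%E = (r^-1)%:E :> \bar R.
Proof.
move=> r0.
(* Counting from 2 keeps the left endpoint strictly below 1, as the fundamental theorem of calculus
   requires. *)
pose F (n : nat) : set R := [set` `[n.+2%:R^-1, (1:R)]].
have F1 n : (n.+2%:R^-1 < 1 :> R)%R by rewrite invf_lt1// ltr1n.
have E n : (\int[mu]_(t in F n) (t `^ (r - 1))%R%:E)%E =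
    (r^-1 - r^-1 * n.+2%:R^-1 `^ r)%R%:E.
  have := @continuous_FTC2 R (fun t => t `^ (r - 1))%R
    (fun t => r^-1 * t `^ r)%R _ _ (F1 n).
  rewrite powR1 mulr1 -EFinB; apply.
  - apply: derivable_within_continuous => t /=; rewrite in_itv/= => /andP[t0 _].
    by apply: derivable_powR; rewrite in_itv/= andbT (lt_le_trans _ t0).
  - have dF t : (0 < t)%R -> derivable (fun t => r^-1 * t `^ r)%R t 1.
      by move=> t0; apply: derivableM => //; apply: derivable_powR; rewrite in_itv/= t0.
    have cF t : (0 < t)%R -> {for t, continuous (fun t => r^-1 * t `^ r)%R}.
      by move=> t0; apply/differentiable_continuous/derivable1_diffP/dF.
    split.
    + by move=> t; rewrite in_itv/= => /andP[t0 _]; apply: dF; apply: lt_trans t0.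
    + by apply: cvg_at_right_filter; apply: cF.
    + by apply: cvg_at_left_filter; apply: cF.
  - move=> t; rewrite in_itv/= => /andP[t0 _].
    have {}t0 : (0 < t)%R by apply: lt_trans t0.
    rewrite derive1E deriveZ/=; last by apply: derivable_powR; rewrite in_itv/= t0.
    rewrite -derive1E powR_derive1 ?in_itv/= ?t0// /GRing.scale/= mulrA mulVf ?mul1r//.
    by rewrite gt_eqF.
have UF : \bigcup_n F n = [set` `]0, (1:R)]].
  apply/seteqP; split => [t [n _]|t]; rewrite /F/= !in_itv/=.
    by move=> /andP[t0 ->]; rewrite (lt_le_trans _ t0).
  move=> /andP[t0 t1]; have [n] := ltr_add_invr t0.
  rewrite add0r => nt; exists n => //=; rewrite in_itv/= t1 andbT.
  by rewrite (le_trans _ (ltW nt))// lef_pV2 ?posrE// ler_nat.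
have -> : (\int[mu]_t unit_powR r t)%E =
    (\int[mu]_(t in \bigcup_n F n) (t `^ (r - 1))%R%:E)%E.
  rewrite UF [RHS]integral_mkcond; apply: eq_integral => t _.
  rewrite /unit_powR patchE/= mem_setE in_itv/=.
  by case: ltP => //= _; case: leP.
have : (\int[mu]_(t in F n) (t `^ (r - 1))%R%:E)%E @[n --> \oo] -->
    (\int[mu]_(t in \bigcup_n F n) (t `^ (r - 1))%R%:E)%E.
  apply: ge0_nondecreasing_set_cvg_integral.
  - move=> m n mn; apply/subsetPset => t; rewrite /F/= !in_itv/= => /andP[mt ->].
    rewrite andbT (le_trans _ mt)// lef_pV2 ?posrE// ler_nat !ltnS//.
  - by move=> n; exact: measurable_itv.
  - by move=> n; apply: measurable_funTS; apply/measurable_EFinP; exact: measurable_powR.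
  - by move=> n t _; rewrite lee_fin powR_ge0.
under eq_fun do rewrite E.
move=> H; apply: (cvg_unique _ H) => //.
apply: cvg_EFin; first exact: nearW.
rewrite [X in _ --> X](_ : _ = r^-1 - r^-1 * 0)%R; last by rewrite mulr0 subr0.
apply: cvgB; first exact: cvg_cst.
apply: cvgM; first exact: cvg_cst.
have := powR_cvg0 r0.
move/cvg_at_rightP; apply; split => //.
have := @cvg_harmonic R; rewrite -(cvg_shiftS _).
by apply: cvg_trans; apply: near_eq_cvg; exact: nearW.
Qed.

End unit_power_integral.

(** * The gamma function: finiteness, and its behaviour at 0 *)

Section gamma_mass.
Context {R : realType}.
Local Notation mu := (@lebesgue_measure R).
Local Open Scope ereal_scope.
Implicit Types (s r t x : R).

Lemma gamma_mass_ge0 s : 0 <= gamma_mass s :> \bar R.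
Proof. by apply: integral_ge0 => t _; exact: gamma_fun_ge0. Qed.

Lemma gamma_fun1E t : gamma_fun 1 t = if (0 < t)%R then (expR (- t))%:E else 0.
Proof. by rewrite /gamma_fun subrr powRr0 mul1r. Qed.

Lemma gamma_mass1 : gamma_mass 1 = 1 :> \bar R.
Proof.
rewrite -(integral_exponential_pdf (@ltr01 R)) /gamma_mass.
rewrite [RHS](_ : _ = \int[mu]_(t in `[0%R, +oo[) (expR (- t))%:E); last first.
  rewrite [RHS]integral_mkcond; apply: eq_integral => t _.
  rewrite /exponential_pdf !patchE; case: ifPn => // _.
  by rewrite mul1r mulN1r.
rewrite -integral_itv_obnd_cbnd; last first.
  by apply: measurable_funTS; apply/measurable_EFinP; exact: measurableT_comp.
rewrite [RHS]integral_mkcond; apply: eq_integral => t _.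
by rewrite gamma_fun1E patchE mem_setE in_itv/= andbT.
Qed.

(** On ]0, 1] the exponential is at most 1; beyond 1 the power is at most 1 and Gamma(1) = 1 bounds
    the rest. Together with [gamma_mass_ge] this gives r Gamma(r) = 1 + O(r) as r tends to 0. *)
Lemma gamma_mass_le r : (0 < r <= 1)%R -> gamma_mass r <= (r^-1 + 1)%:E :> \bar R.
Proof.
move=> /andP[r0 r1]; rewrite EFinD -(integral_unit_powR r0) -gamma_mass1.
rewrite -ge0_integralD//.
- apply: ge0_le_integral => //.
  + by move=> t _; exact: gamma_fun_ge0.
  + exact: measurable_gamma_fun.
  + by apply: emeasurable_funD; [exact: measurable_unit_powR|exact: measurable_gamma_fun].
  + move=> t _; rewrite gamma_fun1E /gamma_fun /unit_powR.
    case: ifPn => t0; last by rewrite adde0.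
    have [t1|t1] := leP t 1%R.
      rewrite -EFinD lee_fin -[leLHS]addr0 lerD ?expR_ge0//.
      by rewrite ler_piMr ?powR_ge0// expR_le1 oppr_le0 ltW.
    rewrite add0e lee_fin ler_piMl ?expR_ge0//.
    by rewrite -[leRHS](powRr0 t) ler_powR ?subr_le0// ltW.
- by move=> t _; exact: unit_powR_ge0.
- exact: measurable_unit_powR.
- by move=> t _; exact: gamma_fun_ge0.
- exact: measurable_gamma_fun.
Qed.

(** From e^-t >= e^-1 on ]0, 1]. It yields positivity and the estimate 1 / Gamma(s) <= e s. *)
Lemma gamma_mass_ge_inv s : (0 < s)%R -> (s^-1 * expR (-1))%:E <= gamma_mass s :> \bar R.
Proof.
move=> s0; rewrite mulrC EFinM -(integral_unit_powR s0) -ge0_integralZl//.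
- apply: ge0_le_integral => //.
  + by move=> t _; rewrite mule_ge0 ?unit_powR_ge0// lee_fin expR_ge0.
  + by apply: emeasurable_funM => //; exact: measurable_unit_powR.
  + exact: measurable_gamma_fun.
  + move=> t _; rewrite /gamma_fun /unit_powR.
    case: ifPn => t0; last by rewrite mule0.
    have [t1|t1] := leP t 1%R; last by rewrite mule0 lee_fin mulr_ge0 ?powR_ge0 ?expR_ge0.
    by rewrite -EFinM lee_fin mulrC ler_wpM2l ?powR_ge0// ler_expR lerN2.
- exact: measurable_unit_powR.
- by move=> t _; exact: unit_powR_ge0.
Qed.

Lemma gamma_mass_gt0 s : (0 < s)%R -> 0 < gamma_mass s :> \bar R.
Proof.
move=> s0; apply: lt_le_trans (gamma_mass_ge_inv s0).
by rewrite lte_fin mulr_gt0 ?invr_gt0 ?expR_gt0.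
Qed.

(** From e^-t >= 1 - t on ]0, 1]: the correction is the integral of t^r. *)
Lemma gamma_mass_ge r : (0 < r)%R ->
  (r^-1)%:E <= gamma_mass r + ((r + 1)^-1)%:E :> \bar R.
Proof.
move=> r0; have r10 : (0 < r + 1)%R by rewrite addr_gt0.
rewrite -(integral_unit_powR r0) -(integral_unit_powR r10) -ge0_integralD//.
- apply: ge0_le_integral => //.
  + by move=> t _; exact: unit_powR_ge0.
  + exact: measurable_unit_powR.
  + by apply: emeasurable_funD; [exact: measurable_gamma_fun|exact: measurable_unit_powR].
  + move=> t _; rewrite /gamma_fun /unit_powR.
    case: ifPn => t0; last by rewrite adde0.
    have [t1|t1] := leP t 1%R; last by rewrite adde0 lee_fin mulr_ge0 ?powR_ge0 ?expR_ge0.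
    rewrite -EFinD lee_fin addrK.
    rewrite -(mulr_powRB1 (ltW t0) r0) [X in (_ <= _ + X)%R]mulrC -mulrDr.
    rewrite ler_peMr ?powR_ge0//.
    by have := expR_ge1Dx (- t); lra.
- by move=> t _; exact: gamma_fun_ge0.
- exact: measurable_gamma_fun.
- by move=> t _; exact: unit_powR_ge0.
- exact: measurable_unit_powR.
Qed.

Lemma gamma_massM s r :
  gamma_mass s * gamma_mass r =
  (\int[mu]_w beta_fun s r w) * gamma_mass (s + r) :> \bar R.
Proof.
rewrite -integral_conv; last 4 first.
- exact: measurable_gamma_fun.
- exact: measurable_gamma_fun.
- exact: gamma_fun_ge0.
- exact: gamma_fun_ge0.
rewrite conv_gamma_fun ge0_integralZl//.
- exact: measurable_gamma_fun.
- by move=> t _; exact: gamma_fun_ge0.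
- by apply: integral_ge0 => w _; exact: beta_fun_ge0.
Qed.

(* By [gamma_massM], finiteness at s / 2 implies finiteness at s. *)
Lemma gamma_mass_fin s : (0 < s)%R -> gamma_mass s \is a @fin_num R.
Proof.
move=> s0; rewrite ge0_fin_numE ?gamma_mass_ge0//.
have [n] : exists n, (s <= 2 ^+ n)%R.
  exists (Num.bound s); apply: ltW; apply: lt_trans (archi_boundP (ltW s0)) _.
  by rewrite -natrX ltr_nat ltn_expl.
elim: n s s0 => [|n IH] s s0 sn.
  apply: le_lt_trans (gamma_mass_le _) _; last exact: ltry.
  by rewrite s0.
have h0 : (0 < s / 2)%R by rewrite divr_gt0.
have /(IH _ h0) hlty : (s / 2 <= 2 ^+ n)%R by rewrite ler_pdivrMr// -exprSr.
have := gamma_massM (s / 2) (s / 2); rewrite -splitr => H.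
rewrite ltNge leye_eq; apply/negP => /eqP sy; move: H; rewrite sy.
have B0 : 0 <= \int[mu]_w beta_fun (s / 2) (s / 2) w.
  by apply: integral_ge0 => w _; exact: beta_fun_ge0.
have hfin : gamma_mass (s / 2) \is a fin_num.
  by rewrite ge0_fin_numE ?gamma_mass_ge0.
have := gamma_mass_gt0 h0; rewrite -(fineK hfin) -EFinM lte_fin => f0.
(* If Gamma(s) is infinite, the product formula equates a finite number with B times +oo. Since 0
   times +oo is 0, the case B = 0 is refuted by Gamma(s / 2) > 0, and the case B > 0 by
   finiteness. *)
move: B0; rewrite le_eqVlt => /predU1P[<-|B0].
  rewrite mul0e => -[] /eqP; rewrite mulf_eq0 orbb => /eqP e.
  by rewrite e ltxx in f0.
by rewrite gt0_muley.
Qed.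

Lemma fine_gamma_mass_gt0 s : (0 < s)%R -> (0 < fine (@gamma_mass R s))%R.
Proof.
by move=> s0; rewrite fine_gt0// gamma_mass_gt0//= -ge0_fin_numE ?gamma_mass_ge0 ?gamma_mass_fin.
Qed.

End gamma_mass.

(** * Normalised gamma densities *)

Section gamma_density.
Context {R : realType}.
Local Notation mu := (@lebesgue_measure R).
Local Open Scope ereal_scope.
Implicit Types (s r t x : R).

(** The value 0 for s <= 0 lets the integral over the parameter s run over all of R. *)
Definition gamma_pdf s t : \bar R :=
  if (0 < s)%R then ((fine (gamma_mass s))^-1)%:E * gamma_fun s t else 0.

Lemma gamma_pdf_ge0 s t : 0 <= gamma_pdf s t.
Proof.
rewrite /gamma_pdf; case: ifPn => // s0; rewrite mule_ge0 ?gamma_fun_ge0//.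
by rewrite lee_fin invr_ge0 ltW// fine_gamma_mass_gt0.
Qed.

Lemma measurable_gamma_pdf2 :
  measurable_fun setT (fun p : R * R => gamma_pdf p.1 p.2).
Proof.
(* The factor 1 / Gamma(s) becomes exp(- ln Gamma(s)), a composition of measurable functions, valid
   because Gamma(s) > 0 for s > 0. *)
rewrite [X in measurable_fun _ X](_ : _ = fun p : R * R =>
    if (0 < p.1)%R then
      (expR (- ln (fine (gamma_mass p.1))))%:E * gamma_fun p.1 p.2
    else 0).
  apply: measurable_if_ltr => //.
  apply: emeasurable_funM; last exact: measurable_gamma_fun2.
  have mG : measurable_fun setT (@gamma_mass R).
    apply: (@measurable_fun_fubini_tonelli_F _ _ _ _ R mu
      (fun p => gamma_fun p.1 p.2)); first exact: measurable_gamma_fun2.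
    by move=> p; exact: gamma_fun_ge0.
  apply/measurable_EFinP.
  have m1 : measurable_fun setT (fun s : R => expR (- ln (fine (gamma_mass s))))%R.
    apply: measurableT_comp => //; apply: measurableT_comp => //.
    by apply: measurableT_comp => //; exact: measurableT_comp.
  exact: (measurableT_comp m1 measurable_fst).
apply/funext => p; rewrite /gamma_pdf; case: ifPn => // p0.
by rewrite expRN lnK// posrE fine_gamma_mass_gt0.
Qed.

Lemma measurable_gamma_pdf s : measurable_fun setT (gamma_pdf s).
Proof. exact: (measurable_section2 _ measurable_gamma_pdf2). Qed.

Lemma integral_gamma_pdf s : (0 < s)%R -> \int[mu]_t gamma_pdf s t = 1.
Proof.
move=> s0; rewrite /gamma_pdf s0 ge0_integralZl//.
- rewrite -/(gamma_mass s) -[X in _ * X](fineK (gamma_mass_fin s0)).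
  by rewrite -EFinM mulVf// gt_eqF// fine_gamma_mass_gt0.
- exact: measurable_gamma_fun.
- by move=> t _; exact: gamma_fun_ge0.
- by rewrite lee_fin invr_ge0 ltW// fine_gamma_mass_gt0.
Qed.

(** The semigroup law with only one factor normalised, so that Gamma(r) stays visible for the limit
    r -> 0. *)
Lemma conv_gamma_fun_pdf r s : (0 < r)%R -> (0 < s)%R ->
  conv (gamma_fun r) (gamma_pdf s) = fun x => gamma_mass r * gamma_pdf (r + s) x.
Proof.
move=> r0 s0; rewrite /gamma_pdf s0 addr_gt0//; apply/funext => x; rewrite convZ.
- rewrite conv_gamma_fun.
  have := gamma_massM r s.
  set B := \int[_]_w _.
  rewrite -(fineK (gamma_mass_fin r0)) -(fineK (gamma_mass_fin s0)).
  have rs0 : (0 < r + s)%R by rewrite addr_gt0.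
  rewrite -(fineK (gamma_mass_fin rs0)) => H.
  have gs0 := fine_gamma_mass_gt0 s0; have grs0 := fine_gamma_mass_gt0 rs0.
  rewrite !muleA; congr (_ * _).
  move: H; move: (fine (gamma_mass (r + s))) grs0 => c c0.
  move: (fine (gamma_mass s)) gs0 => b b0; move: (fine (gamma_mass r)) => a'.
  move=> /(congr1 (mule (c^-1)%:E)); rewrite [in RHS]muleCA -!EFinM /= mulVf ?gt_eqF//.
  rewrite mule1 => <-; rewrite -EFinM; congr EFin; field.
  by rewrite !gt_eqF.
- exact: measurable_gamma_fun.
- exact: measurable_gamma_fun.
- exact: gamma_fun_ge0.
- exact: gamma_fun_ge0.
- by rewrite lee_fin invr_ge0 ltW// fine_gamma_mass_gt0.
Qed.

End gamma_density.

(** * The Sonine identity *)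

Section sonine.
Context {R : realType}.
Local Notation mu := (@lebesgue_measure R).
Local Open Scope ereal_scope.
Implicit Types (s r t x : R).

(* [volterra] is the paper's S and [upper_gamma 0] is E_1, extended by 0 to
   t <= 0 and taken in the extended reals. *)
Definition volterra t : \bar R := \int[mu]_s gamma_pdf s t.

Definition upper_gamma r x : \bar R :=
  if (0 < x)%R then \int[mu]_u (if (x <= u)%R then gamma_fun r u else 0) else 0.

Lemma volterra_ge0 t : 0 <= volterra t.
Proof. by apply: integral_ge0 => s _; exact: gamma_pdf_ge0. Qed.

Lemma measurable_volterra : measurable_fun setT volterra.
Proof.
apply: (@measurable_fun_fubini_tonelli_F _ _ _ _ R mu
  (fun p => gamma_pdf p.2 p.1)).
  exact: measurable_swap measurable_gamma_pdf2.
by move=> p; exact: gamma_pdf_ge0.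
Qed.

Lemma upper_gamma_ge0 r x : 0 <= upper_gamma r x.
Proof.
rewrite /upper_gamma; case: ifPn => // _; apply: integral_ge0 => u _.
by case: ifPn => // _; exact: gamma_fun_ge0.
Qed.

Lemma measurable_gamma_tail r x :
  measurable_fun setT (fun u => if (x <= u)%R then gamma_fun r u else 0).
Proof.
by apply: measurable_if_ler => //; exact: measurable_gamma_fun.
Qed.

Lemma gamma_tail_ge0 r x u : 0 <= (if (x <= u)%R then gamma_fun r u else 0).
Proof. by case: ifPn => // _; exact: gamma_fun_ge0. Qed.

Lemma measurable_upper_gamma r : measurable_fun setT (upper_gamma r).
Proof.
apply: measurable_if_ltr => //.
apply: (@measurable_fun_fubini_tonelli_F _ _ _ _ R mu
  (fun p : R * R => if (p.1 <= p.2)%R then gamma_fun r p.2 else 0)).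
  apply: measurable_if_ler => //.
  exact: (measurableT_comp (measurable_gamma_fun r) measurable_snd).
by move=> p; exact: gamma_tail_ge0.
Qed.

Lemma conv_heavisideE (f : R -> \bar R) x :
  conv heaviside f x = \int[mu]_y (if (y < x)%R then f y else 0).
Proof.
rewrite /conv; apply: eq_integral => y _; rewrite /heaviside subr_gt0.
by case: ifPn => _; rewrite ?mul1e ?mul0e.
Qed.

(** The gamma integral is cut at x. This brings H_r within reach of the semigroup law. *)
Lemma conv_heaviside_gamma_fun r x :
  conv heaviside (gamma_fun r) x + upper_gamma r x =
  gamma_mass r * heaviside x.
Proof.
rewrite conv_heavisideE /upper_gamma /heaviside; case: ifPn => x0.
  rewrite mule1 -ge0_integralD//.
  - apply: eq_integral => y _; have [yx|xy] := ltP y x.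
      by rewrite adde0.
    by rewrite add0e.
  - by move=> y _; case: ifPn => // _; exact: gamma_fun_ge0.
  - by apply: measurable_if_ltr => //; exact: measurable_gamma_fun.
  - by move=> y _; exact: gamma_tail_ge0.
  - exact: measurable_gamma_tail.
rewrite mule0 adde0 integral0_eq// => y _; case: ifPn => // yx.
rewrite /gamma_fun ltNge.
by rewrite (le_trans (ltW yx))//= leNgt.
Qed.

(* Exponential (Chernoff) moment: it makes the mass of [volterra] on every
   half-line finite. *)
Lemma integral_expR_gamma_pdf s : (0 < s)%R ->
  \int[mu]_y ((expR (- y))%:E * gamma_pdf s y) = (expR (- (s * ln 2)))%:E.
Proof.
move=> s0.
(* The factor e^-y turns the rate 1 of the density into 2, and the substitution y -> 2 y turns it
   back, leaving 2^-s. *)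
have two0 : (2 != 0 :> R)%R by [].
have := ge0_integral_affine 0 two0 (measurable_gamma_pdf s) (gamma_pdf_ge0 s).
rewrite integral_gamma_pdf// mule1 gtr0_norm// => H.
pose f y := gamma_pdf s (2 * y + 0)%R.
transitivity (\int[mu]_y ((expR (- (s * ln 2)) * 2)%:E * f y)).
  apply: eq_integral => y _; rewrite /f addr0 /gamma_pdf s0 muleCA [RHS]muleCA.
  congr (_ * _); rewrite /gamma_fun pmulr_rgt0//.
  case: ifPn => y0; last by rewrite !mule0.
  rewrite -!EFinM; congr EFin.
  rewrite powRM ?ltW// (@gt0_powRE _ (s - 1) 2)// mulrBl mul1r expRB lnK ?posrE//.
  have -> : expR (- (2 * y)) = (expR (- y) * expR (- y))%R.
    by rewrite -expRD; congr expR; ring.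
  rewrite (expRN (s * ln 2)). by field; rewrite gt_eqF ?expR_gt0.
rewrite ge0_integralZl//.
- by rewrite H -EFinM -mulrA divff// mulr1.
- apply: (measurableT_comp (measurable_gamma_pdf s)).
  by apply: measurable_funD => //; exact: measurable_funM.
- by move=> y _; exact: gamma_pdf_ge0.
Qed.

(** The indicator of y < x is at most e^(x - y), which bounds the mass by e^x times the integral of
    2^-s over s > 0, that is e^x / ln 2. *)
Lemma conv_heaviside_volterra_lty x : conv heaviside volterra x < +oo.
Proof.
rewrite conv_heavisideE.
apply: (@le_lt_trans _ _ (\int[mu]_y ((expR (x - y))%:E * volterra y))).
  apply: ge0_le_integral => //.
  - by move=> y _; case: ifPn => // _; exact: volterra_ge0.
  - by apply: measurable_if_ltr => //; exact: measurable_volterra.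
  - apply: emeasurable_funM; last exact: measurable_volterra.
    by apply/measurable_EFinP; apply: measurableT_comp => //; exact: measurable_funB.
  - move=> y _; case: ifPn => yx; last by rewrite mule_ge0 ?volterra_ge0// lee_fin expR_ge0.
    rewrite -[leLHS]mul1e lee_wpmul2r ?volterra_ge0// lee_fin.
    by rewrite -expR0 ler_expR subr_ge0 ltW.
have mE : measurable_fun setT (fun y : R => (expR (- y))%:E).
  by apply/measurable_EFinP; exact: measurableT_comp.
rewrite (_ : (fun _ => _) = fun y => (expR x)%:E * ((expR (- y))%:E * volterra y)); last first.
  by apply/funext => y; rewrite muleA -EFinM -expRD.
rewrite ge0_integralZl//; last 2 first.
- by apply: emeasurable_funM => //; exact: measurable_volterra.
- by move=> y _; rewrite mule_ge0 ?volterra_ge0// lee_fin expR_ge0.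
apply: lte_mul_pinfty; [by rewrite lee_fin expR_ge0|by []|].
rewrite /volterra.
under eq_integral => y _.
  rewrite -ge0_integralZl//; last 2 first.
  - exact: measurable_section1 measurable_gamma_pdf2.
  - by move=> s _; exact: gamma_pdf_ge0.
  over.
rewrite (@fubini_tonelli _ _ _ _ R mu mu
  (fun p => (expR (- p.1))%:E * gamma_pdf p.2 p.1))/=; last 2 first.
- apply: emeasurable_funM.
    exact: (measurableT_comp mE measurable_fst).
  exact: measurable_swap measurable_gamma_pdf2.
- by move=> p; rewrite mule_ge0 ?gamma_pdf_ge0// lee_fin expR_ge0.
have l20 : (ln 2 != 0 :> R)%R by rewrite gt_eqF// ln_gt0// ltr1n.
(* The integral of e^(- s ln 2) is Gamma(1) rescaled by ln 2. *)
have := ge0_integral_affine 0 l20 (measurable_gamma_fun 1) (gamma_fun_ge0 1).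
rewrite -/(gamma_mass 1) gamma_mass1 mule1 => H.
rewrite (_ : \int[_]_y _ = \int[mu]_s gamma_fun 1 (ln 2 * s + 0)%R).
  by rewrite H ltry.
apply: eq_integral => s _; rewrite addr0 gamma_fun1E pmulr_rgt0 ?ln_gt0 ?ltr1n//.
case: ifPn => s0; last first.
  by rewrite integral0_eq// => y _; rewrite /gamma_pdf (negbTE s0) mule0.
by rewrite integral_expR_gamma_pdf// mulrC.
Qed.

End sonine.

(** * Incomplete gamma functions and the regularised identity for r > 0 *)

Section sonine_bounds.
Context {R : realType}.
Local Notation mu := (@lebesgue_measure R).
Local Open Scope ereal_scope.
Implicit Types (s r t x : R).

(** [conv heaviside (gamma_pdf s) x] is the regularised lower incomplete gamma function P(s, x), the
    distribution function of the gamma law, here studied as a function of its parameter s. *)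
Lemma gamma_cdf_measurable x :
  measurable_fun setT (fun s : R => conv heaviside (gamma_pdf s) x).
Proof.
apply: (@measurable_fun_fubini_tonelli_F _ _ _ _ R mu
  (fun p : R * R => heaviside (x - p.2)%R * gamma_pdf p.1 p.2)).
  apply: emeasurable_funM; last exact: measurable_gamma_pdf2.
  apply: (measurableT_comp measurable_heaviside).
  exact: measurable_funB.
by move=> p; rewrite mule_ge0 ?heaviside_ge0 ?gamma_pdf_ge0.
Qed.

Lemma gamma_cdf_ge0 s x : 0 <= conv heaviside (gamma_pdf s) x.
Proof.
by apply: conv_ge0; [exact: heaviside_ge0|exact: gamma_pdf_ge0].
Qed.

Lemma gamma_cdf_le0 s x : (s <= 0)%R -> conv heaviside (gamma_pdf s) x = 0.
Proof.
move=> s0; rewrite /conv integral0_eq// => y _.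
by rewrite /gamma_pdf ltNge s0 mule0.
Qed.

Lemma gamma_cdf_le1 s x : conv heaviside (gamma_pdf s) x <= 1.
Proof.
have [s0|s0] := leP s 0%R; first by rewrite gamma_cdf_le0.
rewrite -(integral_gamma_pdf s0); apply: ge0_le_integral => //.
- by move=> y _; rewrite mule_ge0 ?heaviside_ge0 ?gamma_pdf_ge0.
- by apply: measurable_conv_integrand; [exact: measurable_heaviside|exact: measurable_gamma_pdf].
- exact: measurable_gamma_pdf.
- move=> y _; rewrite /heaviside; case: ifPn => _; first by rewrite mul1e.
  by rewrite mul0e gamma_pdf_ge0.
Qed.

Lemma conv_heaviside_volterraE x :
  conv heaviside volterra x = \int[mu]_s conv heaviside (gamma_pdf s) x.
Proof.
rewrite /volterra conv_integral//.
- exact: measurable_heaviside.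
- exact: measurable_gamma_pdf2.
- exact: heaviside_ge0.
- by move=> *; exact: gamma_pdf_ge0.
Qed.

Lemma integral_gt_shift r (k : \bar R) (F : R -> \bar R) :
  measurable_fun setT F -> (forall s, 0 <= F s) -> 0 <= k ->
  k * (\int[mu]_s (if (r < s)%R then F s else 0)) =
  \int[mu]_s (if (0 < s)%R then k * F (r + s)%R else 0).
Proof.
move=> mF F0 k0; pose f s := if (r < s)%R then F s else 0.
have mf : measurable_fun setT f by exact: measurable_if_ltr.
have f0 s : 0 <= f s by rewrite /f; case: ifPn.
have mfr : measurable_fun setT (fun s => f (s + r)%R).
  by apply: (measurableT_comp mf); exact: measurable_funD.
rewrite -/f -(ge0_integral_shift r mf f0) -ge0_integralZl//.
apply: eq_integral => s _; rewrite /f ltrDr addrC.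
by case: ifPn => // _; rewrite mule0.
Qed.

(** Convolution with [gamma_fun r] shifts every parameter s to r + s: what remains of the integral
    over s is the part above r, times Gamma(r). *)
Lemma conv_heaviside_gamma_volterra r x : (0 < r)%R ->
  conv (conv heaviside (gamma_fun r)) volterra x =
  gamma_mass r * \int[mu]_s (if (r < s)%R then conv heaviside (gamma_pdf s) x else 0).
Proof.
move=> r0.
have mg := @measurable_gamma_fun R r.
have g0 := @gamma_fun_ge0 R r.
have mh := @measurable_heaviside R.
have h0 := @heaviside_ge0 R.
rewrite /volterra conv_integral; last 4 first.
- exact: measurable_conv.
- exact: measurable_gamma_pdf2.
- by move=> y; exact: conv_ge0.
- by move=> *; exact: gamma_pdf_ge0.
rewrite integral_gt_shift; last 3 first.
- exact: gamma_cdf_measurable.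
- by move=> s; exact: gamma_cdf_ge0.
- exact: gamma_mass_ge0.
apply: eq_integral => s _.
have [s0|s0] := leP s 0%R.
  rewrite /conv integral0_eq// => y _.
  by rewrite /gamma_pdf ltNge s0 mule0.
rewrite -convA//; last 2 first.
- exact: measurable_gamma_pdf.
- exact: gamma_pdf_ge0.
rewrite conv_gamma_fun_pdf// convZ//.
- exact: measurable_gamma_pdf.
- exact: gamma_pdf_ge0.
- exact: gamma_mass_ge0.
Qed.

(** The integral over all s minus the part above r. The subtraction is legitimate because
    [conv_heaviside_volterra_lty] makes the subtracted term finite. *)
Lemma upper_gamma_volterra r x : (0 < r)%R ->
  conv (upper_gamma r) volterra x =
  gamma_mass r * \int[mu]_s (if (s <= r)%R then conv heaviside (gamma_pdf s) x else 0).
Proof.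
move=> r0.
have mg := @measurable_gamma_fun R r.
have g0 := @gamma_fun_ge0 R r.
have mh := @measurable_heaviside R.
have h0 := @heaviside_ge0 R.
have mv := @measurable_volterra R.
have v0 := @volterra_ge0 R.
have mU := @measurable_upper_gamma R r.
have U0 := @upper_gamma_ge0 R r.
have mhg : measurable_fun setT (conv heaviside (gamma_fun r)) by exact: measurable_conv.
have hg0 y : 0 <= conv heaviside (gamma_fun r) y by exact: conv_ge0.
have mP := gamma_cdf_measurable x.
have P0 s := gamma_cdf_ge0 s x.
have H : conv (conv heaviside (gamma_fun r)) volterra x +
         conv (upper_gamma r) volterra x =
         gamma_mass r * conv heaviside volterra x.
  apply: conv_split => //; first exact: gamma_mass_ge0.
  exact: conv_heaviside_gamma_fun.
move: H; rewrite conv_heaviside_gamma_volterra//.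
set I2 := \int[_]_s _; set I1 := \int[_]_s _.
have AE : conv heaviside volterra x = I2 + I1.
  rewrite conv_heaviside_volterraE -ge0_integralD//.
  - apply: eq_integral => s _; have [rs|sr] := ltP r s; first by rewrite adde0.
    by rewrite add0e.
  - by move=> s _; case: ifPn.
  - exact: measurable_if_ltr.
  - by move=> s _; case: ifPn.
  - exact: measurable_if_ler.
have I20 : 0 <= I2 by apply: integral_ge0 => s _; case: ifPn.
have I10 : 0 <= I1 by apply: integral_ge0 => s _; case: ifPn.
have I2fin : I2 \is a fin_num.
  rewrite ge0_fin_numE//; apply: le_lt_trans (conv_heaviside_volterra_lty x).
  by rewrite AE leeDl.
clearbody I1 I2.
have Gfin : gamma_mass r * I2 \is a fin_num by rewrite fin_numM// gamma_mass_fin.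
rewrite AE ge0_muleDr// => /(congr1 (fun z => z - gamma_mass r * I2)).
rewrite [_ + gamma_mass r * I1]addeC [X in X - _]addeC /= !addeK//.
Qed.

(** P(s, x) <= 1 bounds the integral over ]0, r] by r, and (1 / r + 1) r = 1 + r. *)
Lemma upper_gamma_volterra_le r x : (0 < r <= 1)%R ->
  conv (upper_gamma r) volterra x <= (1 + r)%:E.
Proof.
move=> /andP[r0 r1]; rewrite upper_gamma_volterra//.
have -> : (1 + r)%:E = (r^-1 + 1)%:E * r%:E :> \bar R.
  by rewrite -EFinM mulrDl mulVf ?mul1r// gt_eqF.
apply: lee_pmul; first exact: gamma_mass_ge0.
- by apply: integral_ge0 => s _; case: ifPn => // _; exact: gamma_cdf_ge0.
- by apply: gamma_mass_le; rewrite r0.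
have -> : r%:E = \int[mu]_(s in `]0%R, r]) (cst 1 s).
  by rewrite integral_cst// mul1e /= lebesgue_measure_itv/= lte_fin r0 oppr0 adde0.
rewrite [leRHS]integral_mkcond; apply: ge0_le_integral => //.
- by move=> s _; case: ifPn => // _; exact: gamma_cdf_ge0.
- by apply: measurable_if_ler => //; exact: gamma_cdf_measurable.
- by apply/(measurable_restrictT _ _).1 => //; exact: measurable_cst.
- move=> s _; rewrite patchE mem_setE in_itv/=.
  have [s0|s0] := leP s 0%R.
    by rewrite gamma_cdf_le0//= if_same.
  by case: ifPn => // _; exact: gamma_cdf_le1.
Qed.

Lemma upper_gamma0_lty x : upper_gamma 0 x < +oo.
Proof.
rewrite /upper_gamma; case: ifPn => // x0.
apply: (@le_lt_trans _ _ (\int[mu]_u ((x^-1)%:E * gamma_fun 1 u))).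
  apply: ge0_le_integral => //.
  - by move=> u _; exact: gamma_tail_ge0.
  - exact: measurable_gamma_tail.
  - by apply: emeasurable_funM => //; exact: measurable_gamma_fun.
  - move=> u _; have [xu|ux] := leP x u; last first.
      by rewrite mule_ge0 ?gamma_fun_ge0// lee_fin invr_ge0 ltW.
    have u0 := lt_le_trans x0 xu.
    rewrite gamma_fun1E /gamma_fun u0 -EFinM lee_fin ler_wpM2r ?expR_ge0//.
    rewrite sub0r powR_inv1; last exact: ltW.
    by rewrite lef_pV2 ?posrE.
rewrite ge0_integralZl//.
- by rewrite -/(gamma_mass 1) gamma_mass1 mule1 ltry.
- exact: measurable_gamma_fun.
- by move=> u _; exact: gamma_fun_ge0.
- by rewrite lee_fin invr_ge0 ltW.
Qed.

(** Weighted arithmetic-geometric inequality for 1 and u. It combines two instances of e^z >= 1 + z,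
    with weights r and 1 - r for which the terms in ln u cancel. *)
Lemma powR_le_affine (u r : R) : (0 < u)%R -> (0 <= r <= 1)%R ->
  (u `^ r <= 1 - r + r * u)%R.
Proof.
move=> u0 /andP[r0 r1]; rewrite gt0_powRE//; set l := ln u; set v := expR (r * l).
have v0 : (0 <= v)%R by exact: expR_ge0.
have e1 : (u = v * expR ((1 - r) * l))%R.
  by rewrite /v -expRD -[LHS]lnK ?posrE//; congr expR; rewrite -/l; ring.
have e2 : (1 = v * expR (- (r * l)))%R by rewrite /v -expRD subrr expR0.
suff : (v <= (1 - r) * (v * expR (- (r * l))) + r * (v * expR ((1 - r) * l)))%R.
  by rewrite -e1 -e2 mulr1.
have h1 : (v * (1 + (1 - r) * l) <= v * expR ((1 - r) * l))%R.
  by rewrite ler_wpM2l// expR_ge1Dx.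
have h2 : (v * (1 - r * l) <= v * expR (- (r * l)))%R.
  by rewrite ler_wpM2l// expR_ge1Dx.
have r1' : (0 <= 1 - r)%R by rewrite subr_ge0.
have h3 := ler_wpM2l r0 h1; have h4 := ler_wpM2l r1' h2.
apply: le_trans (lerD h4 h3); rewrite le_eqVlt; apply/orP; left; apply/eqP; ring.
Qed.

(** Dividing u^r <= 1 - r + r u by u gives u^(r - 1) <= u^-1 + r; integrating r e^-u costs at most r
    Gamma(1) = r. *)
Lemma upper_gamma_le r x : (0 <= r <= 1)%R ->
  upper_gamma r x <= upper_gamma 0 x + r%:E * heaviside x.
Proof.
move=> r01; have /andP[r0 r1] := r01.
rewrite /upper_gamma /heaviside; case: ifPn => x0; last by rewrite mule0 adde0.
rewrite mule1 -[X in _ + X]mule1 -(@gamma_mass1 R) -ge0_integralZl//; last 2 first.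
- exact: measurable_gamma_fun.
- by move=> u _; exact: gamma_fun_ge0.
rewrite -ge0_integralD//; last 4 first.
- by move=> u _; exact: gamma_tail_ge0.
- exact: measurable_gamma_tail.
- by move=> u _; rewrite mule_ge0 ?gamma_fun_ge0.
- by apply: emeasurable_funM => //; exact: measurable_gamma_fun.
apply: ge0_le_integral => //.
- by move=> u _; exact: gamma_tail_ge0.
- exact: measurable_gamma_tail.
- apply: emeasurable_funD; first exact: measurable_gamma_tail.
  by apply: emeasurable_funM => //; exact: measurable_gamma_fun.
- move=> u _; have [xu|ux] := leP x u; last first.
    by rewrite add0e mule_ge0 ?gamma_fun_ge0.
  have u0 := lt_le_trans x0 xu.
  rewrite gamma_fun1E /gamma_fun u0 -EFinM -EFinD lee_fin.
  rewrite -mulrDl ler_wpM2r ?expR_ge0// sub0r powR_inv1 ?(ltW u0)//.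
  rewrite powRB ?(gt_eqF u0) ?implybT// powRr1 ?(ltW u0)// ler_pdivrMr//.
  apply: le_trans (powR_le_affine u0 r01) _.
  by rewrite mulrDl mulVf ?gt_eqF//; lra.
Qed.

(** On the tail, u >= x >= d gives u^r >= d^r. The cutoff is unavoidable for r > 0: H_r is bounded
    by Gamma(r) near 0 and E_1 is not, so no positive multiple of E_1 stays below H_r there. *)
Lemma upper_gamma_ge r d x : (0 <= r)%R -> (0 < d <= 1)%R -> (d <= x)%R ->
  (d `^ r)%:E * upper_gamma 0 x <= upper_gamma r x.
Proof.
move=> r0 /andP[d0 d1] dx; have x0 := lt_le_trans d0 dx.
rewrite /upper_gamma x0 -ge0_integralZl//; last 3 first.
- exact: measurable_gamma_tail.
- by move=> u _; exact: gamma_tail_ge0.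
- by rewrite lee_fin powR_ge0.
apply: ge0_le_integral => //.
- by move=> u _; rewrite mule_ge0 ?gamma_tail_ge0// lee_fin powR_ge0.
- by apply: emeasurable_funM => //; exact: measurable_gamma_tail.
- exact: measurable_gamma_tail.
- move=> u _; have [xu|ux] := leP x u; last by rewrite mule0.
  have u0 := lt_le_trans x0 xu.
  rewrite /gamma_fun u0 -EFinM lee_fin mulrA ler_wpM2r ?expR_ge0//.
  rewrite sub0r powR_inv1 ?(ltW u0)// powRB ?(gt_eqF u0) ?implybT// powRr1 ?(ltW u0)//.
  rewrite ler_wpM2r ?invr_ge0 ?(ltW u0)// ge0_ler_powR ?nnegrE ?(ltW d0) ?(ltW u0)//.
  exact: le_trans xu.
Qed.

End sonine_bounds.

(** * The limit r -> 0 *)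

Section sonine_identity.
Context {R : realType}.
Local Notation mu := (@lebesgue_measure R).
Local Open Scope ereal_scope.
Implicit Types (s r t x : R).

(** Replaces the limit r -> 0: every error term below is linear in r, so no convergence of extended
    reals has to be discussed. *)
Lemma lee_small_slope (z w : \bar R) (K : R) : (0 <= K)%R ->
  (forall r : R, (0 < r <= 1)%R -> z <= w + (r * K)%:E) -> z <= w.
Proof.
move=> K0 H; apply/lee_addgt0Pr => e e0.
have K10 : (0 < K + 1)%R by rewrite ltr_wpDl.
pose r : R := Num.min 1%R (e / (K + 1))%R.
have r0 : (0 < r)%R by rewrite lt_min ltr01 divr_gt0.
apply: le_trans (H r _) _; first by rewrite r0 ge_min lexx.
apply: leeD => //; rewrite lee_fin.
apply: (@le_trans _ _ (e / (K + 1) * (K + 1))%R); last by rewrite divfK ?gt_eqF.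
apply: ler_pM => //; first exact: ltW.
- by rewrite ge_min lexx orbT.
- by rewrite lerDl.
Qed.

Lemma volterra_le0 t : (t <= 0)%R -> volterra t = 0 :> \bar R.
Proof.
move=> t0; rewrite /volterra integral0_eq// => s _; rewrite /gamma_pdf.
by case: ifPn => // _; rewrite /gamma_fun ltNge t0 mule0.
Qed.

(** 1 - P(s, x) = H_s(x) / Gamma(s), where H_s(x) <= E_1(x) + s <= E_1(x) + 1 and 1 / Gamma(s) <= e
    s. This explains the constant. *)
Lemma gamma_cdf_ge s x : (0 < s <= 1)%R -> (0 < x)%R ->
  1 <= conv heaviside (gamma_pdf s) x +
       (s * (expR 1 * (fine (upper_gamma 0 x) + 1)))%:E.
Proof.
move=> /andP[s0 s1] x0.
have -> : conv heaviside (gamma_pdf s) x =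
    ((fine (gamma_mass s))^-1)%:E * conv heaviside (gamma_fun s) x.
  rewrite -convZ.
  - by congr (conv _ _ x); apply/funext => y; rewrite /gamma_pdf s0.
  - exact: measurable_heaviside.
  - exact: measurable_gamma_fun.
  - exact: heaviside_ge0.
  - exact: gamma_fun_ge0.
  - by rewrite lee_fin invr_ge0 ltW// fine_gamma_mass_gt0.
have := conv_heaviside_gamma_fun s x; rewrite /heaviside x0 mule1 -/heaviside.
have U0 : upper_gamma 0 x = (fine (upper_gamma 0 x))%:E :> \bar R.
  by rewrite fineK// ge0_fin_numE ?upper_gamma_ge0// upper_gamma0_lty.
have : upper_gamma s x <= (fine (upper_gamma 0 x) + s)%:E.
  have := @upper_gamma_le R s x; rewrite /heaviside x0 mule1 {1}U0 -EFinD.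
  by apply; rewrite ltW.
have u0 : (0 <= fine (upper_gamma 0 x))%R by rewrite fine_ge0// upper_gamma_ge0.
move: (fine (upper_gamma 0 x)) u0 {U0} => u u0.
have := upper_gamma_ge0 s x.
have : 0 <= conv heaviside (gamma_fun s) x.
  by apply: conv_ge0; [exact: heaviside_ge0|exact: gamma_fun_ge0].
have := gamma_mass_ge_inv s0.
rewrite -(fineK (gamma_mass_fin s0)); have := fine_gamma_mass_gt0 s0.
move: (fine (gamma_mass s)) => G G0.
move: (conv _ _ x) => [p| |]//; move: (upper_gamma s x) => [q| |]//.
rewrite !lee_fin => Gs p0 q0 qu [pq].
rewrite /=.
have h1 : (1 <= G * (s * expR 1))%R.
  have se0 : (0 <= s * expR 1)%R by rewrite mulr_ge0 ?expR_ge0// ltW.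
  apply: le_trans (ler_wpM2r se0 Gs); rewrite le_eqVlt; apply/orP; left; apply/eqP.
  by rewrite expRN; field; rewrite !gt_eqF ?expR_gt0.
have h2 : (u + 1 <= (u + 1) * (G * (s * expR 1)))%R by rewrite ler_peMr//; lra.
rewrite -(ler_pM2l G0) mulr1 mulrDr mulrA mulfV ?gt_eqF// mul1r -pq lerD2l.
by nra.
Qed.

Lemma itv_integral_cst r (c : R) : (0 < r)%R ->
  \int[mu]_(s in `]0%R, r]) (c%:E) = (c * r)%:E.
Proof.
move=> r0; rewrite integral_cst//= lebesgue_measure_itv/= lte_fin r0.
by rewrite oppr0 adde0.
Qed.

Lemma upper_gamma_volterra_ge x : (0 < x)%R ->
  exists2 C : R, (0 <= C)%R & forall r : R, (0 < r <= 1)%R ->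
    1 <= conv (upper_gamma r) volterra x + (r * C)%:E.
Proof.
move=> x0; set C0 := (expR 1 * (fine (upper_gamma 0 x) + 1))%R.
have C00 : (0 <= C0)%R.
  by rewrite mulr_ge0 ?expR_ge0// addr_ge0// fine_ge0// upper_gamma_ge0.
(* The summand 1 comes from r Gamma(r) >= 1 - r; the factor 2 from r Gamma(r) <= 1 + r <= 2, which
   multiplies the error r C0 of the integral of P. *)
exists (2 * C0 + 1)%R; first by lra.
move=> r r01; have /andP[r0 r1] := r01; rewrite upper_gamma_volterra//.
set I := \int[_]_s _.
have I0 : 0 <= I.
  by apply: integral_ge0 => s _; case: ifPn => // _; exact: gamma_cdf_ge0.
(* [gamma_cdf_ge] integrated over ]0, r], with s C0 bounded by r C0. *)
have rI : r%:E <= I + (r * C0 * r)%:E.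
  rewrite -[r in leLHS]mul1r -itv_integral_cst// -itv_integral_cst//.
  have -> : I = \int[mu]_(s in `]0%R, r]) conv heaviside (gamma_pdf s) x.
    rewrite [RHS]integral_mkcond; apply: eq_integral => s _.
    rewrite patchE mem_setE in_itv/=; have [s0|s0] //= := leP s 0%R.
    by rewrite gamma_cdf_le0// if_same.
  have mP := gamma_cdf_measurable x.
  rewrite -ge0_integralD//.
  - apply: ge0_le_integral => //.
    + by apply: emeasurable_funD => //; exact: measurable_funTS.
    + move=> s /=; rewrite in_itv/= => /andP[s0 sr].
      apply: le_trans (@gamma_cdf_ge s x _ x0) _.
        by rewrite s0 (le_trans sr).
      by apply: leeD => //; rewrite lee_fin ler_wpM2r.
  - by move=> s _; exact: gamma_cdf_ge0.
  - exact: measurable_funTS.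
  - by move=> s _; rewrite lee_fin mulr_ge0// ltW.
have := @gamma_mass_le R r r01; have := gamma_mass_ge r0.
rewrite -(fineK (gamma_mass_fin r0)); have := fine_gamma_mass_gt0 r0.
move: (fine (gamma_mass r)) => G G0.
clearbody I; move: I I0 rI => [i| |]// i0; last first.
  by move=> *; rewrite gt0_muley ?lte_fin// addye// leey.
rewrite -!EFinM -!EFinD !lee_fin => ri H1 H2.
have ri0 : (0 < r^-1)%R by rewrite invr_gt0.
have rr : (r * r^-1 = 1)%R by rewrite divff ?gt_eqF.
have rr1 : (r * (r + 1)^-1 <= r)%R.
  by rewrite ler_piMr ?(ltW r0)// invf_le1 ?lerDr ?(ltW r0)// addr_gt0.
have h1 : (1 <= r * G + r)%R.
  by have := ler_wpM2l (ltW r0) H1; rewrite rr mulrDr; lra.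
have h2 : (r * G <= 1 + r)%R.
  by apply: le_trans (ler_wpM2l (ltW r0) H2) _; rewrite mulrDr rr mulr1.
have h3 : (G * r <= G * i + (r * G) * (r * C0))%R.
  by have := ler_wpM2l (ltW G0) ri; rewrite mulrDr; lra.
have h4 : ((r * G) * (r * C0) <= 2 * (r * C0))%R.
  by apply: ler_wpM2r; [rewrite mulr_ge0 ?(ltW r0)|lra].
by lra.
Qed.

(** Replacing H_r by E_1 costs r times (1 * S)(x), which is finite, so the total error is again
    linear in r. *)
Lemma sonine_ge x : (0 < x)%R -> 1 <= conv (upper_gamma 0) volterra x.
Proof.
move=> x0; have [C C0 HC] := upper_gamma_volterra_ge x0.
have mv := @measurable_volterra R.
have v0 := @volterra_ge0 R.
have mh := @measurable_heaviside R.
have h0 := @heaviside_ge0 R.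
have hvfin : conv heaviside volterra x = (fine (conv heaviside volterra x))%:E.
  by rewrite fineK// ge0_fin_numE ?conv_ge0// conv_heaviside_volterra_lty.
have A0 : (0 <= fine (conv heaviside volterra x))%R by rewrite fine_ge0// conv_ge0.
apply: (@lee_small_slope _ _ (fine (conv heaviside volterra x) + C)).
  exact: addr_ge0.
move=> r r01; have /andP[r0 r1] := r01.
have mU := @measurable_upper_gamma R.
have U0 := @upper_gamma_ge0 R.
have r01' : (0 <= r <= 1)%R by rewrite ltW.
have := HC r r01.
have : conv (upper_gamma r) volterra x <= conv (upper_gamma 0) volterra x +
    r%:E * conv heaviside volterra x.
  have r0' : 0 <= r%:E by rewrite lee_fin ltW.
  by apply: le_conv_comb => // y; exact: upper_gamma_le.
rewrite hvfin; move: (conv (upper_gamma r) _ _) (conv (upper_gamma 0) _ _).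
move: (fine _) => A p q pq; move/le_trans; apply.
by rewrite mulrDr EFinD addeA leeD2r.
Qed.

Let cut d y : \bar R := if (d <= y)%R then upper_gamma 0 y else 0.

Let measurable_cut d : measurable_fun setT (cut d).
Proof. by apply: measurable_if_ler => //; exact: measurable_upper_gamma. Qed.

Let cut_ge0 d y : 0 <= cut d y.
Proof. by rewrite /cut; case: ifPn => // _; exact: upper_gamma_ge0. Qed.

(** Beyond the cutoff d^r E_1 <= H_r, hence d^r z <= 1 + r for the left-hand side z; then r tends to
    0 with d fixed. *)
Lemma sonine_cut_le d x : (0 < d <= 1)%R -> conv (cut d) volterra x <= 1.
Proof.
move=> d01; have /andP[d0 d1] := d01.
have mv := @measurable_volterra R.
have v0 := @volterra_ge0 R.
have mU := @measurable_upper_gamma R.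
have U0 := @upper_gamma_ge0 R.
have H (r : R) : (0 < r <= 1)%R ->
    (d `^ r)%:E * conv (cut d) volterra x <= (1 + r)%:E.
  move=> r01; have /andP[r0 r1] := r01.
  apply: le_trans (upper_gamma_volterra_le x r01).
  have dr0 : 0 <= (d `^ r)%:E by rewrite lee_fin powR_ge0.
  apply: le_convZ => // y; rewrite /cut; case: ifPn => dy; last by rewrite mule0.
  by apply: upper_gamma_ge => //; exact: ltW.
have z0 : 0 <= conv (cut d) volterra x by exact: conv_ge0.
(* The instance r = 1 already excludes an infinite value. *)
move: (conv _ _ x) z0 H => [z| |]// z0 H; last first.
  have := H 1%R; rewrite ltr01 lexx => /(_ isT).
  by rewrite gt0_muley ?lte_fin ?powR_gt0.
have lnd : (ln d <= 0)%R by exact: ln_le0.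
apply: (@lee_small_slope _ _ (1 - ln d * z)%R).
  by have := mulr_le0_ge0 lnd z0; lra.
move=> r r01; have := H r r01; rewrite -EFinM -EFinD !lee_fin => Hr.
(* d^r = e^(r ln d) >= 1 + r ln d makes the bound linear in r; the slope is nonnegative since ln d
   <= 0. *)
have : ((1 + r * ln d) * z <= d `^ r * z)%R.
  by rewrite ler_wpM2r// gt0_powRE// expR_ge1Dx.
by lra.
Qed.

(** Monotone convergence along the cutoffs d = 1 / (n + 1); at each point the truncated kernel is
    eventually equal to E_1. *)
Lemma sonine_le x : conv (upper_gamma 0) volterra x <= 1.
Proof.
have mv := @measurable_volterra R.
have v0 := @volterra_ge0 R.
pose g (n : nat) (y : R) := cut (n.+1%:R^-1)%R (x - y)%R * volterra y.
have d01 (n : nat) : (0 < (n.+1%:R^-1 : R) <= 1)%R.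
  by rewrite invr_gt0 ltr0Sn andTb invf_le1 ?ler1n ?ltr0Sn.
have mg n : measurable_fun setT (g n) by exact: measurable_conv_integrand.
have g0 n y : setT y -> 0 <= g n y by move=> _; exact: mule_ge0.
have gnd y : setT y -> nondecreasing_seq (g ^~ y).
  move=> _ m n mn; apply: lee_wpmul2r => //; rewrite /cut.
  case: ifPn => [mxy|_]; last first.
    by case: ifPn => // _; exact: upper_gamma_ge0.
  rewrite ifT//; apply: le_trans mxy; rewrite lef_pV2 ?posrE ?ltr0Sn//.
  by rewrite ler_nat.
have := @cvg_monotone_convergence _ _ R mu setT measurableT g mg g0 gnd.
rewrite (_ : \int[mu]_y _ = conv (upper_gamma 0) volterra x).
  move=> H; apply: (cvge_le _ H).
  by apply: nearW => n; exact: sonine_cut_le.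
apply: eq_integral => y _; apply: cvg_lim => //.
rewrite /g; have [xy|xy] := leP (x - y)%R 0%R.
  have -> : upper_gamma 0 (x - y) = 0 :> \bar R by rewrite /upper_gamma ltNge xy.
  rewrite mul0e; apply: cvg_near_cst; apply: nearW => n.
  rewrite /cut ifF ?mul0e//; apply/negbTE; rewrite -ltNge.
  by apply: le_lt_trans xy _; have /andP[] := d01 n.
apply: cvg_near_cst.
have [N] := ltr_add_invr xy; rewrite add0r => NE.
exists N => // n /= Nn; rewrite /cut ifT//.
apply: le_trans (ltW NE); rewrite lef_pV2 ?posrE ?ltr0Sn//.
by rewrite ler_nat.
Qed.

Lemma sonine : conv (upper_gamma 0) volterra = @heaviside R.
Proof.
apply/funext => x; rewrite /heaviside; case: ifPn => x0.
  by apply/eqP; rewrite eq_le sonine_le sonine_ge.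
rewrite /conv integral0_eq// => y _; have [y0|y0] := leP y 0%R.
  by rewrite volterra_le0 ?mule0.
rewrite /upper_gamma ifF ?mul0e//; apply/negbTE; rewrite -leNgt subr_le0.
by apply: le_trans (ltW y0); rewrite leNgt.
Qed.

End sonine_identity.

(** * The real-valued kernels as [fine] of the extended ones *)

Section kernels.
Context {R : realType}.
Local Notation mu := (@lebesgue_measure R).
Implicit Types (s r t x : R).

(* Also true at +oo, because [fine +oo = 0] and [0 * +oo = 0]. *)
Lemma fineM_ge0 (x y : \bar R) : (0 <= x)%E -> (0 <= y)%E ->
  fine (x * y)%E = fine x * fine y.
Proof.
move: x y => [x| |] [y| |]//; rewrite ?lee_fin => x0 y0.
- move: x0; rewrite le_eqVlt => /predU1P[<-|x0]; first by rewrite mul0e mul0r.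
  by rewrite gt0_muley ?lte_fin//= mulr0.
- move: y0; rewrite le_eqVlt => /predU1P[<-|y0]; first by rewrite mule0 mulr0.
  by rewrite gt0_mulye ?lte_fin//= mul0r.
- by rewrite mulyy/= mulr0.
Qed.

Lemma expint1E x : 0 < x -> expint1 x = fine (upper_gamma 0 x).
Proof.
move=> x0; rewrite /expint1 /Rintegral /upper_gamma x0; congr fine.
rewrite [LHS]integral_mkcond; apply: eq_integral => u _.
rewrite patchE mem_setE in_itv/= andbT; case: ifPn => // xu.
rewrite /gamma_fun (lt_le_trans x0 xu) sub0r powR_inv1 ?(ltW (lt_le_trans x0 xu))//.
by rewrite mulrC.
Qed.

Lemma GammaE s : Gamma s = fine (gamma_mass s).
Proof.
rewrite /Gamma /Rintegral; congr fine.
rewrite [LHS]integral_mkcond; apply: eq_integral => u _.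
by rewrite patchE mem_setE in_itv/= andbT.
Qed.

(** No finiteness is required: both sides turn out to be [fine] of the same extended real, which may
    be infinite. *)
Lemma SkernelE t : 0 < t -> Skernel t = fine (volterra t).
Proof.
move=> t0; rewrite /Skernel -[expR _]/(fine (expR (- t))%:E) /Rintegral.
rewrite -fineM_ge0; last 2 first.
- by rewrite lee_fin expR_ge0.
- apply: integral_ge0 => s /=; rewrite in_itv/= andbT => s0.
  by rewrite lee_fin divr_ge0 ?powR_ge0// GammaE ltW// fine_gamma_mass_gt0.
congr fine; rewrite /volterra [in LHS]integral_mkcond.
have mgp := @measurable_section1 R _ t measurable_gamma_pdf2.
pose f s := ((expR t)%:E * gamma_pdf s t)%E.
rewrite (_ : (\int[_]_s _)%E = (\int[mu]_s f s)%E); last first.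
  apply: eq_integral => s _; rewrite patchE mem_setE in_itv/= andbT /f /gamma_pdf.
  case: ifPn => s0; last by rewrite mule0.
  rewrite /gamma_fun t0 GammaE -!EFinM; congr EFin.
  by rewrite expRN; field; rewrite !gt_eqF ?expR_gt0 ?fine_gamma_mass_gt0.
rewrite ge0_integralZl//; last by move=> s _; exact: gamma_pdf_ge0.
move: (\int[_]_x _)%E => I.
by rewrite muleA -EFinM expRN mulVf ?mul1e// gt_eqF// expR_gt0.
Qed.

End kernels.

Section scaling.
Context {R : realType}.
Local Notation mu := (@lebesgue_measure R).
Local Open Scope ereal_scope.
Implicit Types (f g : R -> \bar R) (c x : R).

Lemma measurable_rescale c f : measurable_fun setT f ->
  measurable_fun setT (fun x => f (x * c)%R).
Proof. by move=> mf; apply: (measurableT_comp mf); exact: measurable_funM. Qed.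

(** With c = 1 / alpha or - 1 / alpha, the Jacobian is the alpha that the factor in front of J
    cancels. *)
Lemma conv_rescale c f g x : c != 0%R ->
  measurable_fun setT f -> measurable_fun setT g ->
  (forall y, 0 <= f y) -> (forall y, 0 <= g y) ->
  conv (fun y => f (y * c)%R) (fun y => g (y * c)%R) x =
  `|c^-1|%:E * conv f g (x * c)%R.
Proof.
move=> c0 mf mg f0 g0; rewrite /conv.
rewrite -(@ge0_integral_affine _ c 0 (fun y => f (x * c - y)%R * g y))//.
- by apply: eq_integral => y _; rewrite addr0 mulrBl (mulrC y).
- exact: measurable_conv_integrand.
- by move=> y; exact: mule_ge0.
Qed.

End scaling.

(** * Integral operators on an interval *)

Section fine_integrals.
Context d (T : measurableType d) {R : realType} (mu : {measure set T -> \bar R}).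
Implicit Types (D : set T) (Q u v w : T -> \bar R) (psi : T -> R).

Lemma fine_integrable D Q : measurable D -> measurable_fun D Q ->
  (forall t, D t -> (0 <= Q t)%E) -> (\int[mu]_(t in D) Q t < +oo)%E ->
  mu.-integrable D (fun t => (fine (Q t))%:E).
Proof.
move=> mD mQ Q0 Qoo; apply: (@le_integrable _ _ _ mu D mD _ Q).
- apply/measurable_EFinP; apply: (measurableT_comp _ mQ) => //.
- move=> t Dt; have := Q0 _ Dt; case: (Q t) => [q| |]//= _.
  by rewrite normr0 leey.
- apply/integrableP; split => //; apply: le_lt_trans Qoo.
  rewrite le_eqVlt; apply/orP; left; apply/eqP.
  by apply: eq_integral => t /set_mem /Q0; exact: gee0_abs.
Qed.

Lemma fine_Rintegral D Q : measurable D -> measurable_fun D Q ->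
  (forall t, D t -> (0 <= Q t)%E) -> (\int[mu]_(t in D) Q t < +oo)%E ->
  \int[mu]_(t in D) fine (Q t) = fine (\int[mu]_(t in D) Q t)%E.
Proof.
move=> mD mQ Q0 Qoo; rewrite /Rintegral; congr fine.
have iQ : mu.-integrable D Q.
  apply/integrableP; split => //; apply: le_lt_trans Qoo.
  rewrite le_eqVlt; apply/orP; left; apply/eqP.
  by apply: eq_integral => t /set_mem /Q0; exact: gee0_abs.
apply: ae_eq_integral => //.
  by apply/measurable_EFinP; apply: (measurableT_comp _ mQ).
have := integrable_ae mD iQ; apply: filterS => t /= H Dt.
by rewrite fineK//; exact: H.
Qed.

Lemma ae_eq_integrable D Q Q' : measurable D -> measurable_fun D Q' ->
  mu.-integrable D Q -> ae_eq mu D Q Q' ->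
  mu.-integrable D Q' /\ (\int[mu]_(t in D) Q t = \int[mu]_(t in D) Q' t)%E.
Proof.
move=> mD mQ' iQ QQ'; have mQ := measurable_int mu iQ.
split; last exact: ae_eq_integral.
apply/integrableP; split => //; have /integrableP[_] := iQ; apply: le_lt_trans.
rewrite le_eqVlt; apply/orP; left; apply/eqP; apply: ae_eq_integral => //.
- exact: measurableT_comp.
- exact: measurableT_comp.
- by move: QQ'; apply: filterS => t H Dt; rewrite (H Dt).
Qed.

(** The bridge from signed real integrals to nonnegative extended ones. As [fine] is multiplicative
    on nonnegative extended reals, points where w, u or v is infinite need no separate treatment. *)
Lemma weighted_split D w u v psi : measurable D ->
  measurable_fun D w -> measurable_fun D u -> measurable_fun D v ->
  (forall t, 0 <= w t)%E -> (forall t, 0 <= u t)%E -> (forall t, 0 <= v t)%E ->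
  measurable_fun D psi ->
  (\forall t \ae mu, D t -> psi t = fine (u t) - fine (v t)) ->
  (\int[mu]_(t in D) (w t * u t) < +oo)%E ->
  (\int[mu]_(t in D) (w t * v t) < +oo)%E ->
  mu.-integrable D (fun t => (fine (w t) * psi t)%:E) /\
  \int[mu]_(t in D) (fine (w t) * psi t) =
  fine (\int[mu]_(t in D) (w t * u t))%E - fine (\int[mu]_(t in D) (w t * v t))%E.
Proof.
move=> mD mw mu_ mv w0 u0 v0 mpsi psiE wu wv.
have mwu : measurable_fun D (fun t => w t * u t)%E by exact: emeasurable_funM.
have mwv : measurable_fun D (fun t => w t * v t)%E by exact: emeasurable_funM.
have wu0 t : D t -> (0 <= w t * u t)%E by move=> _; exact: mule_ge0.
have wv0 t : D t -> (0 <= w t * v t)%E by move=> _; exact: mule_ge0.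
have iu := fine_integrable mD mwu wu0 wu.
have iv := fine_integrable mD mwv wv0 wv.
have mwpsi : measurable_fun D (fun t => (fine (w t) * psi t)%:E).
  apply/measurable_EFinP; apply: measurable_funM => //.
  by apply: (measurableT_comp _ mw).
have E : ae_eq mu D (fun t => (fine (w t * u t)%E)%:E - (fine (w t * v t)%E)%:E)%E
    (fun t => (fine (w t) * psi t)%:E).
  move: psiE; apply: filterS => t H Dt.
  by rewrite (H Dt) !fineM_ge0// mulrBr.
have iB := integrableB mD iu iv.
have [iw eI] := ae_eq_integrable mD mwpsi iB E.
split => //; rewrite -fine_Rintegral// -fine_Rintegral// -RintegralB//.
by rewrite /Rintegral; congr fine; rewrite -eI.
Qed.

End fine_integrals.

Section kernel_operators.
Context {R : realType} (a b : R).
Local Notation mu := (@lebesgue_measure R).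
Local Notation D := ([set` `[a, b]] : set R).
Implicit Types (K E V u v w : R -> \bar R) (phi g : R -> R).

Definition pos_part phi (t : R) : \bar R :=
  if t \in `[a, b] then (Num.max (phi t) 0)%:E else 0%E.

Definition neg_part phi := pos_part (\- phi).

(** One operator stands for all four: the side of integration is encoded in the half-line on which K
    vanishes. *)
Definition kernel_op K phi (x : R) : R :=
  \int[mu]_(t in `[a, b]) (fine (K (x - t)) * phi t).

Lemma pos_part_ge0 phi t : (0 <= pos_part phi t)%E.
Proof. by rewrite /pos_part; case: ifPn => // _; rewrite lee_fin le_max lexx orbT. Qed.

Lemma pos_neg_partE phi t : t \in `[a, b] ->
  phi t = fine (pos_part phi t) - fine (neg_part phi t).
Proof.
rewrite /neg_part /pos_part => ->/=.
have [p0|p0] := leP 0 (phi t); have [q0|q0] := leP 0 (- phi t).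
- by lra.
- by rewrite subr0.
- by lra.
- by lra.
Qed.

Lemma pos_partE phi :
  pos_part phi = ((fun t => (Num.max (phi t) 0)%:E) \_ D).
Proof. by apply/funext => t; rewrite /pos_part patchE mem_setE. Qed.

Lemma measurable_pos_part phi : measurable_fun D phi ->
  measurable_fun setT (pos_part phi).
Proof.
move=> mphi; rewrite pos_partE; apply/(measurable_restrictT _ _).1.
  exact: measurable_itv.
by apply/measurable_EFinP; apply: measurable_maxr.
Qed.

Lemma measurable_neg_part phi : measurable_fun D phi ->
  measurable_fun setT (neg_part phi).
Proof. by move=> mphi; apply: measurable_pos_part; exact: measurable_funN. Qed.

Lemma integral_pos_part_lty phi : mu.-integrable D (EFin \o phi) ->
  (\int[mu]_t pos_part phi t < +oo)%E.
Proof.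
move=> /integrableP[mphi]; apply: le_lt_trans.
rewrite pos_partE -integral_mkcond; apply: ge0_le_integral => //.
- by move=> t _; rewrite lee_fin le_max lexx orbT.
- by apply/measurable_EFinP; apply: measurable_maxr => //; exact/measurable_EFinP.
- exact: measurableT_comp.
- by move=> t _ /=; rewrite lee_fin ge_max ler_norm normr_ge0.
Qed.

Lemma integral_neg_part_lty phi : mu.-integrable D (EFin \o phi) ->
  (\int[mu]_t neg_part phi t < +oo)%E.
Proof.
move=> iphi; apply: integral_pos_part_lty.
rewrite (_ : EFin \o _ = (-%E \o (EFin \o phi)))//.
by apply: integrableN => //; exact: measurable_itv.
Qed.

Lemma integral_mul_suppr u v : (forall t, ~ D t -> v t = 0%E) ->
  (\int[mu]_(t in D) (u t * v t) = \int[mu]_t (u t * v t))%E.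
Proof.
move=> v0; rewrite integral_mkcond; apply: eq_integral => t _.
rewrite patchE; case: ifPn => // /negP tD.
by rewrite v0 ?mule0// => Dt; apply: tD; rewrite inE.
Qed.

Lemma integral_mul_suppl u v : (forall t, ~ D t -> u t = 0%E) ->
  (\int[mu]_(t in D) (u t * v t) = \int[mu]_t (u t * v t))%E.
Proof.
move=> u0; under eq_integral do rewrite muleC.
by rewrite integral_mul_suppr//; apply: eq_integral => t _; rewrite muleC.
Qed.

Lemma pos_part_out phi t : ~ D t -> pos_part phi t = 0%E.
Proof. by rewrite /pos_part /=; case: ifPn. Qed.

Lemma kernel_opE K phi x : measurable_fun setT K -> (forall t, 0 <= K t)%E ->
  measurable_fun D phi ->
  (conv K (pos_part phi) x < +oo)%E -> (conv K (neg_part phi) x < +oo)%E ->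
  kernel_op K phi x =
  fine (conv K (pos_part phi) x) - fine (conv K (neg_part phi) x).
Proof.
move=> mK K0 mphi; rewrite /conv.
rewrite -integral_mul_suppr; last exact: pos_part_out.
rewrite -integral_mul_suppr; last exact: pos_part_out.
move=> hp hn; rewrite /kernel_op.
have mKx : measurable_fun setT (fun t : R => K (x - t)).
  by apply: (measurableT_comp mK); exact: measurable_funB.
have mp := measurable_pos_part mphi.
have mn := measurable_neg_part mphi.
have mD : measurable (D : set (measurableTypeR R)) by exact: measurable_itv.
have pE : \forall t \ae mu,
    D t -> phi t = fine (pos_part phi t) - fine (neg_part phi t).
  by apply/aeW => t Dt; exact: pos_neg_partE.
exact: (weighted_split mD (measurable_funTS mKx) (measurable_funTS mp)
  (measurable_funTS mn) (fun t => K0 (x - t)) (pos_part_ge0 phi)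
  (pos_part_ge0 _) mphi pE hp hn).2.
Qed.

(** For x and t in [a, b] the difference x - t lies in [- (b - a), b - a]; V may be truncated there,
    and the integral of a convolution is the product of the integrals. *)
Lemma integral_conv_itv_lty V u : measurable_fun setT V -> measurable_fun setT u ->
  (forall t, 0 <= V t)%E -> (forall t, 0 <= u t)%E ->
  (forall c : R, \int[mu]_t (if ((t : R) \in `[- c, c])%R then V t else 0) < +oo)%E ->
  (forall t, ~ D t -> u t = 0%E) -> (\int[mu]_t u t < +oo)%E ->
  (\int[mu]_(x in D) conv V u x < +oo)%E.
Proof.
move=> mV mu_ V0 u0 Vloc uD uoo.
pose W t : \bar R := if t \in `[- (b - a), b - a] then V t else 0%E.
have mW : measurable_fun setT W.
  rewrite (_ : W = V \_ [set` `[- (b - a), b - a]]); last first.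
    by apply/funext => t; rewrite /W patchE mem_setE.
  by apply/(measurable_restrictT _ _).1; [exact: measurable_itv|exact: measurable_funTS].
have W0 t : (0 <= W t)%E by rewrite /W; case: ifPn.
apply: (@le_lt_trans _ _ (\int[mu]_x conv W u x)%E); last first.
  rewrite integral_conv//; apply: lte_mul_pinfty => //.
    by apply: integral_ge0 => t _; exact: W0.
  by rewrite ge0_fin_numE ?Vloc//; apply: integral_ge0 => t _; exact: W0.
rewrite integral_mkcond; apply: ge0_le_integral => //.
- by move=> x _; rewrite patchE; case: ifPn => // _; exact: conv_ge0.
- apply/(measurable_restrictT _ _).1; first exact: measurable_itv.
  by apply: measurable_funTS; exact: measurable_conv.
- exact: measurable_conv.
- move=> x _; rewrite patchE; case: ifPn => [xD|_]; last exact: conv_ge0.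
  apply: ge0_le_integral => //.
  + by move=> t _; exact: mule_ge0.
  + exact: measurable_conv_integrand.
  + exact: measurable_conv_integrand.
  + move=> t _; have [tD|tD] := boolP (t \in `[a, b]); last first.
      by rewrite uD ?mule0//=; exact/negP.
    rewrite /W ifT//; move: xD tD; rewrite inE/= !in_itv/=.
    by move=> /andP[? ?] /andP[? ?]; apply/andP; split; lra.
Qed.

Lemma ae_fine_itv (Q : R -> \bar R) : measurable_fun setT Q ->
  (forall t, 0 <= Q t)%E -> (\int[mu]_(t in D) Q t < +oo)%E ->
  \forall t \ae mu, D t -> Q t \is a fin_num.
Proof.
move=> mQ Q0 Qoo; apply: (@integrable_ae _ _ _ mu); first exact: measurable_itv.
apply/integrableP; split; first exact: measurable_funTS.
apply: le_lt_trans Qoo; rewrite le_eqVlt; apply/orP; left; apply/eqP.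
by apply: eq_integral => t _; exact: gee0_abs.
Qed.

End kernel_operators.

(** * Composition of two kernel operators *)

Section kernel_composition.
Context {R : realType} (a b : R) (E V : R -> \bar R) (phi : R -> R).
Local Notation mu := (@lebesgue_measure R).
Local Notation D := ([set` `[a, b]] : set R).
Hypotheses (mE : measurable_fun setT E) (mV : measurable_fun setT V).
Hypotheses (E0 : forall t, (0 <= E t)%E) (V0 : forall t, (0 <= V t)%E).
Hypothesis Vloc : forall c : R,
  (\int[mu]_t (if ((t : R) \in `[- c, c])%R then V t else 0) < +oo)%E.
Hypothesis iphi : mu.-integrable D (EFin \o phi).

Let mphi : measurable_fun D phi.
Proof. by move/measurable_int : iphi => /measurable_EFinP. Qed.

Let p := pos_part a b phi.
Let n := neg_part a b phi.
Let mp : measurable_fun setT p := measurable_pos_part mphi.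
Let mn : measurable_fun setT n := measurable_neg_part mphi.
Let p0 t : (0 <= p t)%E. Proof. exact: pos_part_ge0. Qed.
Let n0 t : (0 <= n t)%E. Proof. exact: pos_part_ge0. Qed.

Lemma conv_pos_part_lty : (\int[mu]_(x in D) conv V p x < +oo)%E.
Proof.
apply: integral_conv_itv_lty => //; first by move=> t; exact: pos_part_out.
exact: integral_pos_part_lty.
Qed.

Lemma conv_neg_part_lty : (\int[mu]_(x in D) conv V n x < +oo)%E.
Proof.
apply: integral_conv_itv_lty => //; first by move=> t; exact: pos_part_out.
exact: integral_neg_part_lty.
Qed.

Let mP : measurable_fun setT (conv V p). Proof. exact: measurable_conv. Qed.
Let mN : measurable_fun setT (conv V n). Proof. exact: measurable_conv. Qed.
Let P0 t : (0 <= conv V p t)%E. Proof. exact: conv_ge0. Qed.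
Let N0 t : (0 <= conv V n t)%E. Proof. exact: conv_ge0. Qed.

Lemma kernel_op_ae :
  \forall t \ae mu, D t ->
    kernel_op a b V phi t = fine (conv V p t) - fine (conv V n t).
Proof.
have := ae_fine_itv mP P0 conv_pos_part_lty.
have := ae_fine_itv mN N0 conv_neg_part_lty.
apply: (@filterS2 _ _ (ae_filter_ringOfSetsType mu)) => t H1 H2 Dt; apply: kernel_opE => //.
- by rewrite -ge0_fin_numE//; exact: H2.
- by rewrite -ge0_fin_numE//; exact: H1.
Qed.

Variable g : R -> R.
Hypothesis mg : measurable_fun D g.
Hypothesis gE : g = kernel_op a b V phi %[ae mu in D].

Lemma kernel_op_range_ae :
  \forall t \ae mu, D t -> g t = fine (conv V p t) - fine (conv V n t).
Proof.
have := kernel_op_ae; have := gE; apply: (@filterS2 _ _ (ae_filter_ringOfSetsType mu)) => t H1 H2 Dt.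
by rewrite (H1 Dt) (H2 Dt).
Qed.

(** [weighted_split] with weight 1. Integrability is part of the definition of a fractional
    derivative, hence must be shown for f and g. *)
Lemma kernel_op_range_integrable : mu.-integrable D (EFin \o g).
Proof.
have mD : measurable (D : set (measurableTypeR R)) by exact: measurable_itv.
have [] := @weighted_split _ (measurableTypeR R) R mu D (cst 1%E) (conv V p) (conv V n) g mD.
- exact: measurable_cst.
- exact: measurable_funTS.
- exact: measurable_funTS.
- by [].
- exact: P0.
- exact: N0.
- exact: mg.
- exact: kernel_op_range_ae.
- by under eq_integral do rewrite mul1e; exact: conv_pos_part_lty.
- by under eq_integral do rewrite mul1e; exact: conv_neg_part_lty.
rewrite (_ : (fun t => _) = EFin \o g)//.
by apply/funext => t /=; rewrite mul1r.
Qed.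

(* One-sidedness of the two kernels, which makes the integrals over [a, b] and
   over R agree. *)
Hypothesis supp : forall x t u, x \in `[a, b] -> t \notin `[a, b] ->
  u \in `[a, b] -> E (x - t) = 0%E \/ V (t - u) = 0%E.
Hypothesis EVbnd : exists c : R, forall y, (conv E V y <= c%:E)%E.

Let conv_restrict u x : x \in `[a, b] -> (forall t, ~ D t -> u t = 0%E) ->
  (\int[mu]_(t in D) (E (x - t)%R * conv V u t) = conv E (conv V u) x)%E.
Proof.
move=> xD uD; rewrite [RHS]/conv integral_mkcond; apply: eq_integral => t _.
rewrite patchE; case: ifPn => // tD.
have {}tD : (t : R) \notin `[a, b] by apply: contra tD => tD; rewrite inE.
rewrite -/(conv V u t); have [->|] := eqVneq (E (x - t)) 0%E.
  by rewrite mul0e.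
move=> E1; rewrite /conv integral0_eq ?mule0// => s _.
have [sD|sD] := boolP ((s : R) \in `[a, b]); last by rewrite uD ?mule0//; exact/negP.
have [H|->] := supp xD tD sD; last by rewrite mul0e.
by rewrite H eqxx in E1.
Qed.

Let conv_bounded u x : measurable_fun setT u -> (forall t, 0 <= u t)%E ->
  (\int[mu]_t u t < +oo)%E -> (conv (conv E V) u x < +oo)%E.
Proof.
move=> mu_ u0 uoo; have [c Hc] := EVbnd.
have c0 : (0 <= c%:E)%E by apply: le_trans (Hc 0); exact: conv_ge0.
apply: (@le_lt_trans _ _ (\int[mu]_t (c%:E * u t))%E).
  apply: ge0_le_integral => //.
  - by move=> t _; rewrite mule_ge0// conv_ge0.
  - by apply: measurable_conv_integrand => //; exact: measurable_conv.
  - exact: emeasurable_funM.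
  - by move=> t _; exact: lee_wpmul2r.
rewrite ge0_integralZl//; apply: lte_mul_pinfty => //.
Qed.

(** Associativity of [conv], applied to the positive and negative parts of phi. The bound on E * V
    makes both terms finite at every x, so equality holds everywhere on [a, b] although g is given
    only a.e. *)
Lemma kernel_op_comp x : x \in `[a, b] ->
  kernel_op a b E g x = kernel_op a b (conv E V) phi x.
Proof.
move=> xD.
have pD t : ~ D t -> p t = 0%E by exact: pos_part_out.
have nD t : ~ D t -> n t = 0%E by exact: pos_part_out.
have cp := conv_bounded x mp p0 (integral_pos_part_lty iphi).
have cn := conv_bounded x mn n0 (integral_neg_part_lty iphi).
rewrite [RHS]kernel_opE//; last 2 first.
- exact: measurable_conv.
- by move=> t; exact: conv_ge0.
have mD : measurable (D : set (measurableTypeR R)) by exact: measurable_itv.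
have mEx : measurable_fun setT (fun t : R => E (x - t)).
  by apply: (measurableT_comp mE); exact: measurable_funB.
have EP := conv_restrict xD pD; have EN := conv_restrict xD nD.
have EP' := convA mE mV mp E0 V0 p0; have EN' := convA mE mV mn E0 V0 n0.
rewrite EP' in EP; rewrite EN' in EN.
have hp : (\int[mu]_(t in D) (E (x - t)%R * conv V p t) < +oo)%E by rewrite EP.
have hn : (\int[mu]_(t in D) (E (x - t)%R * conv V n t) < +oo)%E by rewrite EN.
have := (weighted_split mD (measurable_funTS mEx) (measurable_funTS mP)
  (measurable_funTS mN) (fun t => E0 (x - t)) P0 N0 mg kernel_op_range_ae hp hn).2.
by rewrite EP EN.
Qed.

End kernel_composition.

(** * Transposition of a kernel operator *)

Section duality.
Context {R : realType} (a b : R).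
Local Notation mu := (@lebesgue_measure R).
Local Notation D := ([set` `[a, b]] : set R).
Implicit Types (V u v : R -> \bar R) (f g phi psi : R -> R).

(** Both sides are the double integral of v(x) V(t - x) u(t): reflecting the kernel transposes the
    convolution. *)
Lemma conv_pairing V u v : measurable_fun setT V -> measurable_fun setT u ->
  measurable_fun setT v -> (forall t, 0 <= V t)%E -> (forall t, 0 <= u t)%E ->
  (forall t, 0 <= v t)%E ->
  (\int[mu]_x (v x * conv (V \o -%R) u x) = \int[mu]_t (u t * conv V v t))%E.
Proof.
move=> mV mu_ mv V0 u0 v0; rewrite /conv.
have mVN : measurable_fun setT (V \o -%R) by exact: measurableT_comp.
have VN0 t : (0 <= (V \o -%R) t)%E by exact: V0.
under eq_integral => x _.
  rewrite -ge0_integralZl//; last 2 first.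
  - exact: measurable_conv_integrand.
  - by move=> t _; exact: mule_ge0.
  over.
rewrite (@fubini_tonelli _ _ _ _ R mu mu
  (fun q : R * R => v q.1 * ((V \o -%R) (q.1 - q.2)%R * u q.2))%E)/=; last 2 first.
- apply: emeasurable_funM; first exact: measurableT_comp.
  apply: emeasurable_funM; last exact: measurableT_comp.
  by apply: (measurableT_comp mVN); exact: measurable_funB.
- by move=> q; rewrite !mule_ge0// VN0.
apply: eq_integral => t _; rewrite -ge0_integralZl//.
- by apply: eq_integral => x _; rewrite opprB muleCA [RHS]muleCA [(v x * _)%E]muleC muleA muleC muleA.
- exact: measurable_conv_integrand.
- by move=> x _; exact: mule_ge0.
Qed.

(** A bounded function against an integrable one: this is where the L^oo density of f and the L^1
    density of g meet. *)
Lemma conv_pairing_lty V psi M u v : measurable_fun setT V -> measurable_fun setT u ->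
  measurable_fun setT v -> (forall t, 0 <= V t)%E -> (forall t, 0 <= u t)%E ->
  (forall t, 0 <= v t)%E ->
  (forall c : R, \int[mu]_t (if ((t : R) \in `[- c, c])%R then V t else 0) < +oo)%E ->
  (forall t, ~ D t -> v t = 0%E) -> (\int[mu]_t v t < +oo)%E ->
  (\forall t \ae mu, D t -> `|psi t| <= M) ->
  (forall t, D t -> u t <= `|psi t|%:E)%E ->
  (\int[mu]_(t in D) (u t * conv V v t) < +oo)%E.
Proof.
move=> mV mu_ mv V0 u0 v0 Vloc vD voo psiM upsi.
have mD : measurable (D : set (measurableTypeR R)) by exact: measurable_itv.
have mC : measurable_fun setT (conv V v) by exact: measurable_conv.
have C0 t : (0 <= conv V v t)%E by exact: conv_ge0.
have M0 : (0 <= (Num.max M 0)%:E)%E by rewrite lee_fin le_max lexx orbT.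
apply: (@le_lt_trans _ _ (\int[mu]_(t in D) ((Num.max M 0)%:E * conv V v t))%E).
  apply: ae_ge0_le_integral => //.
  - by move=> t _; exact: mule_ge0.
  - by apply: measurable_funTS; exact: emeasurable_funM.
  - by move=> t _; exact: mule_ge0.
  - by apply: measurable_funTS; exact: emeasurable_funM.
  - move: psiM; apply: (@filterS _ _ (ae_filter_ringOfSetsType mu)) => t H Dt.
    apply: lee_wpmul2r => //; apply: le_trans (upsi _ Dt) _.
    by rewrite lee_fin le_max H.
rewrite ge0_integralZl//; last exact: measurable_funTS.
by apply: lte_mul_pinfty => //; exact: integral_conv_itv_lty.
Qed.

Lemma pos_part_le_norm phi t : (pos_part a b phi t <= `|phi t|%:E)%E.
Proof.
rewrite /pos_part; case: ifPn => // _.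
by rewrite lee_fin ge_max ler_norm normr_ge0.
Qed.

(** Tonelli's theorem applies only to nonnegative products, so phi w is expanded into four of them,
    each with finite integral. *)
Lemma Rintegral_pos_neg_split w phi (P N : R -> \bar R) :
  measurable_fun D w -> measurable_fun D phi ->
  measurable_fun setT P -> measurable_fun setT N ->
  (forall t, 0 <= P t)%E -> (forall t, 0 <= N t)%E ->
  (\forall t \ae mu, D t -> w t = fine (P t) - fine (N t)) ->
  (\int[mu]_(t in D) (pos_part a b phi t * P t) < +oo)%E ->
  (\int[mu]_(t in D) (pos_part a b phi t * N t) < +oo)%E ->
  (\int[mu]_(t in D) (neg_part a b phi t * P t) < +oo)%E ->
  (\int[mu]_(t in D) (neg_part a b phi t * N t) < +oo)%E ->
  mu.-integrable D (fun t => (phi t * w t)%:E) /\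
  \int[mu]_(t in D) (phi t * w t) =
    (fine (\int[mu]_(t in D) (pos_part a b phi t * P t))%E -
     fine (\int[mu]_(t in D) (pos_part a b phi t * N t))%E) -
    (fine (\int[mu]_(t in D) (neg_part a b phi t * P t))%E -
     fine (\int[mu]_(t in D) (neg_part a b phi t * N t))%E).
Proof.
move=> mw mphi mP mN P0 N0 wE pP pN nP nN.
have mD : measurable (D : set (measurableTypeR R)) by exact: measurable_itv.
have mp := measurable_pos_part mphi; have mn := measurable_neg_part mphi.
have [ip <-] := weighted_split mD (measurable_funTS mp) (measurable_funTS mP)
  (measurable_funTS mN) (pos_part_ge0 a b phi) P0 N0 mw wE pP pN.
have [iN <-] := weighted_split mD (measurable_funTS mn) (measurable_funTS mP)
  (measurable_funTS mN) (pos_part_ge0 a b _) P0 N0 mw wE nP nN.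
have E t : D t -> phi t * w t = fine (pos_part a b phi t) * w t -
    fine (neg_part a b phi t) * w t.
  by move=> Dt; rewrite -mulrBl -pos_neg_partE.
split.
  have := integrableB mD ip iN; apply: eq_integrable => // t /set_mem Dt.
  by rewrite (E _ Dt).
rewrite -RintegralB//; apply: eq_Rintegral => t /set_mem Dt; exact: E.
Qed.

Lemma kernel_op_dual V phi psi f g (M : R) :
  measurable_fun setT V -> (forall t, 0 <= V t)%E ->
  (forall c : R, \int[mu]_t (if ((t : R) \in `[- c, c])%R then V t else 0) < +oo)%E ->
  mu.-integrable D (EFin \o phi) -> mu.-integrable D (EFin \o psi) ->
  (\forall t \ae mu, D t -> `|psi t| <= M) ->
  measurable_fun D f -> measurable_fun D g ->
  f = kernel_op a b (V \o -%R) psi %[ae mu in D] ->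
  g = kernel_op a b V phi %[ae mu in D] ->
  [/\ mu.-integrable D (fun t => (phi t * f t)%:E),
      mu.-integrable D (fun t => (psi t * g t)%:E) &
      \int[mu]_(t in D) (phi t * f t) = \int[mu]_(t in D) (psi t * g t)].
Proof.
move=> mV V0 Vloc iphi ipsi psiM mf mg fE gE.
have mVN : measurable_fun setT (V \o -%R) by exact: measurableT_comp.
have VN0 t : (0 <= (V \o -%R) t)%E by exact: V0.
have VNloc (c : R) :
    (\int[mu]_t (if ((t : R) \in `[- c, c])%R then (V \o -%R) t else 0) < +oo)%E.
  have mVc : measurable_fun setT (fun t : R => if t \in `[- c, c] then V t else 0%E).
    rewrite (_ : (fun _ => _) = V \_ [set` `[- c, c]]); last first.
      by apply/funext => t; rewrite patchE mem_setE.
    by apply/(measurable_restrictT _ _).1; [exact: measurable_itv|exact: measurable_funTS].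
  apply: le_lt_trans (Vloc c); rewrite -(ge0_integral_reflect 0 mVc); last first.
    by move=> t; case: ifPn.
  apply: ge0_le_integral => //.
  - by move=> t _; case: ifPn.
  - rewrite (_ : (fun _ => _) = (V \o -%R) \_ [set` `[- c, c]]); last first.
      by apply/funext => t; rewrite patchE mem_setE.
    by apply/(measurable_restrictT _ _).1; [exact: measurable_itv|exact: measurable_funTS].
  - by apply: (measurableT_comp mVc); exact: measurable_funB.
  - move=> t _; rewrite sub0r.
    have -> : (- (t : R) \in `[- c, c]) = ((t : R) \in `[- c, c]).
      by rewrite !in_itv/= lerN2 andbC [in LHS]lerNl.
    by [].
have mpsi : measurable_fun D psi by move/measurable_int : ipsi => /measurable_EFinP.
have mphi : measurable_fun D phi by move/measurable_int : iphi => /measurable_EFinP.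
have fPN := kernel_op_range_ae mVN VN0 VNloc ipsi fE.
have gPN := kernel_op_range_ae mV V0 Vloc iphi gE.
have mpp := measurable_pos_part mphi; have mpn := measurable_neg_part mphi.
have msp := measurable_pos_part mpsi; have msn := measurable_neg_part mpsi.
have pp0 := pos_part_ge0 a b phi; have pn0 := pos_part_ge0 a b (\- phi).
have sp0 := pos_part_ge0 a b psi; have sn0 := pos_part_ge0 a b (\- psi).
have pair u v : measurable_fun setT u -> measurable_fun setT v ->
    (forall t, 0 <= u t)%E -> (forall t, 0 <= v t)%E ->
    (forall t, ~ D t -> u t = 0%E) -> (forall t, ~ D t -> v t = 0%E) ->
    (\int[mu]_(x in D) (v x * conv (V \o -%R) u x) =
     \int[mu]_(t in D) (u t * conv V v t))%E.
  move=> mu_ mv u0 v0 uD vD.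
  by rewrite (integral_mul_suppl _ vD) (integral_mul_suppl _ uD); exact: conv_pairing.
have pout := @pos_part_out R a b.
have e1 := pair _ _ msp mpp sp0 pp0 (pout psi) (pout phi).
have e2 := pair _ _ msn mpp sn0 pp0 (pout (\- psi)) (pout phi).
have e3 := pair _ _ msp mpn sp0 pn0 (pout psi) (pout (\- phi)).
have e4 := pair _ _ msn mpn sn0 pn0 (pout (\- psi)) (pout (\- phi)).
have ps t : D t -> (pos_part a b psi t <= `|psi t|%:E)%E.
  by move=> _; exact: pos_part_le_norm.
have ns t : D t -> (neg_part a b psi t <= `|psi t|%:E)%E.
  by move=> _; apply: le_trans (pos_part_le_norm _ _) _; rewrite /= normrN.
have ip := integral_pos_part_lty iphi; have iN := integral_neg_part_lty iphi.
(* Only the integrals of a part of psi against V * (a part of phi) are bounded directly; finiteness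
   of the transposed ones is transported along [e1] to [e4]. *)
have l1 := conv_pairing_lty mV msp mpp V0 sp0 pp0 Vloc (pout phi) ip psiM ps.
have l2 := conv_pairing_lty mV msn mpp V0 sn0 pp0 Vloc (pout phi) ip psiM ns.
have l3 := conv_pairing_lty mV msp mpn V0 sp0 pn0 Vloc (pout (\- phi)) iN psiM ps.
have l4 := conv_pairing_lty mV msn mpn V0 sn0 pn0 Vloc (pout (\- phi)) iN psiM ns.
have [i1 E1] := Rintegral_pos_neg_split mf mphi
  (measurable_conv mVN msp VN0 sp0) (measurable_conv mVN msn VN0 sn0)
  (fun t => conv_ge0 t VN0 sp0) (fun t => conv_ge0 t VN0 sn0) fPN
  (eq_ind_r (fun z => z < +oo)%E l1 e1) (eq_ind_r (fun z => z < +oo)%E l2 e2)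
  (eq_ind_r (fun z => z < +oo)%E l3 e3) (eq_ind_r (fun z => z < +oo)%E l4 e4).
have [i2 E2] := Rintegral_pos_neg_split mg mpsi
  (measurable_conv mV mpp V0 pp0) (measurable_conv mV mpn V0 pn0)
  (fun t => conv_ge0 t V0 pp0) (fun t => conv_ge0 t V0 pn0) gPN l1 l3 l2 l4.
split; [exact: i1|exact: i2|].
(* The two expansions list the mixed terms in opposite order, hence the exchange of B' and C'. *)
have swap (A B C F A' B' C' F' X Y : R) :
    X = A - B - (C - F) -> Y = A' - C' - (B' - F') ->
    A = A' -> B = B' -> C = C' -> F = F' -> X = Y.
  by move=> -> -> -> -> -> ->; ring.
exact: swap E1 E2 (congr1 fine e1) (congr1 fine e2) (congr1 fine e3) (congr1 fine e4).
Qed.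

End duality.

(** * Primitives and derivatives *)

Section absolutely_continuous_primitive.
Context {R : realType} (a b : R).
Local Notation mu := (@lebesgue_measure R).
Local Notation D := ([set` `[a, b]] : set R).
Implicit Types (p : R -> R).

Definition primitive p (x : R) : R := \int[mu]_(t in `[a, x]) p t.

Let integrable_itv p (i : interval R) : mu.-integrable setT (EFin \o p) ->
  mu.-integrable [set` i] (EFin \o p).
Proof. by move=> ip; apply: integrableS ip => //; exact: measurable_itv. Qed.

Lemma primitiveB p (u v : R) : mu.-integrable setT (EFin \o p) ->
  a <= u <= v -> primitive p v - primitive p u = \int[mu]_(t in `]u, v[) p t.
Proof.
move=> ip /andP[au uv]; rewrite /primitive Rintegral_itvB ?bnd_simp//; last exact: integrable_itv.
by rewrite -Rintegral_itv_bndo_bndc//; exact: integrable_itv.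
Qed.

(** Absolute continuity of the integral of |p|, applied to the union of the disjoint intervals.
    Dividing by |k| + 1 covers k = 0. *)
Lemma primitive_ac p c k : mu.-integrable setT (EFin \o p) ->
  abs_continuous a b (fun x => c + k * primitive p x).
Proof.
move=> ip e e0.
have k0 : 0 < `|k| + 1 by rewrite ltr_wpDl.
have [d [d0 Hd]] := integral_normr_continuous ip (divr_gt0 e0 k0).
exists d => // n u v uv tI sd.
pose A i : set R := [set` `]u i, v i[].
have mA i : measurable (A i : set (measurableTypeR R)) by exact: measurable_itv.
have mU : measurable (\big[setU/set0]_(i < n) A i : set (measurableTypeR R)).
  by apply: bigsetU_measurable => i _; exact: mA.
have muA i : mu (A i) = (v i - u i)%:E.
  rewrite lebesgue_measure_itv/= lte_fin; have [/andP[_ uvi] _] := uv i.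
  move: uvi; rewrite le_eqVlt => /predU1P[->|->]; last by rewrite EFinB.
  by rewrite ltxx subrr.
have muU : (mu (\big[setU/set0]_(i < n) A i) < d%:E)%E.
  rewrite measure_bigsetU_ord//.
  rewrite (eq_bigr (fun i => (v i - u i)%:E)) => [|i _]; last exact: muA.
  by rewrite sumEFin lte_fin.
have := Hd _ mU muU.
have inp B : measurable (B : set (measurableTypeR R)) ->
    mu.-integrable B (EFin \o (fun t => `|p t|)).
  move=> mB; apply: integrableS (_ : mu.-integrable setT _) => //.
  exact: integrable_abse ip.
have -> : \int[mu]_(x in \big[setU/set0]_(i < n) A i) `|p x| =
    \sum_(i < n) \int[mu]_(x in A i) `|p x|.
  apply: EFin_inj; rewrite -sumEFin /Rintegral fineK; last first.
    exact: integrable_fin_num (inp _ mU).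
  rewrite ge0_integral_bigsetU//.
  - apply: eq_bigr => i _; rewrite fineK//.
    exact: integrable_fin_num (inp _ (mA i)).
  - exact: index_enum_uniq.
  - by move=> i j _ _; exact: tI.
  - by have /measurable_int := inp _ mU.
move=> H; apply: le_lt_trans (_ : (`|k| + 1) * \sum_(i < n) \int[mu]_(x in A i) `|p x| < e); last first.
  by rewrite mulrC -ltr_pdivlMr.
rewrite mulr_sumr; apply: ler_sum => i _.
have [/andP[aui uvi] _] := uv i.
rewrite addrAC opprD addrA subrr sub0r addrC -mulrBr primitiveB//; last by rewrite aui.
rewrite normrM; apply: ler_pM => //; first by rewrite lerDl.
apply: le_normr_Rintegral; first exact: mA.
exact: integrable_itv.
Qed.

Lemma primitive_is_derive p : mu.-integrable setT (EFin \o p) ->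
  \forall x \ae mu, a < x -> is_derive x (1 : R) (primitive p) (p x).
Proof.
move=> ip.
have lp : locally_integrable setT p.
  by apply: open_integrable_locally => //; exact: openT.
have derP (x : R) : derivable (primitive p) x 1 /\ derive1 (primitive p) x = p x ->
    is_derive x (1 : R) (primitive p) (p x).
  move=> [dF F']; apply: DeriveDef; first exact: dF.
  exact: etrans (esym (derive1E _ _)) F'.
have := @FTC1 R p (BLeft a) (fun y => integrable_itv _ ip) lp.
apply: (@filterS _ _ (ae_filter_ringOfSetsType mu)) => x H ax.
by apply: derP; apply: H; rewrite lte_fin.
Qed.

End absolutely_continuous_primitive.

(** * Existence and uniqueness of the a.e. derivative *)

Section ac_derivative.
Context {R : realType} (a b : R).
Local Notation mu := (@lebesgue_measure R).
Local Notation D := ([set` `[a, b]] : set R).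

Lemma abs_continuous_right (F : R -> R) x e : abs_continuous a b F ->
  a <= x < b -> 0 < e ->
  exists2 d, 0 < d & forall y, x <= y < x + d -> y <= b -> `|F y - F x| < e.
Proof.
move=> acF /andP[ax xb] e0; have [d d0 H] := acF e e0; exists d => // y /andP[xy yd] yb.
have := H 1%N (fun=> x) (fun=> y).
rewrite !big_ord1; apply.
- by move=> _; rewrite ax xy.
- by move=> i j _ _ _; rewrite !ord1.
- by rewrite ltrBlDl.
Qed.

(** If F and G differed at x, right continuity would make them differ on an interval to the right of
    x, which has positive measure. Working to the right excludes only b. *)
Lemma abs_continuous_ae_eq (F G : R -> R) :
  abs_continuous a b F -> abs_continuous a b G ->
  F = G %[ae mu in D] -> forall x, a <= x < b -> F x = G x.
Proof.
move=> acF acG FG x axb; apply/eqP; rewrite -subr_eq0 -normr_eq0.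
apply/negPn/negP => FGx.
have e0 : 0 < `|F x - G x| / 2 by rewrite divr_gt0// lt_neqAle eq_sym FGx/=.
have [d1 d10 H1] := abs_continuous_right acF axb e0.
have [d2 d20 H2] := abs_continuous_right acG axb e0.
have /andP[ax xb] := axb.
(* The bound b - x keeps the interval inside [a, b], outside which F and G are arbitrary. *)
pose d := Num.min (Num.min d1 d2) (b - x).
have d0 : 0 < d by rewrite !lt_min d10 d20 subr_gt0.
have N : mu.-negligible [set` `]x, x + d[].
  move: FG; apply: negligibleS => y /=; rewrite in_itv/= => /andP[xy yd] /=.
  have yb : y <= b.
    rewrite -(subrK x b) addrC (le_trans (ltW yd))// lerD2l.
    by rewrite /d ge_min lexx orbT.
  have yd1 : x <= y < x + d1.
    rewrite ltW//= (lt_le_trans yd)// lerD2l /d !ge_min lexx//.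
  have yd2 : x <= y < x + d2.
    by rewrite ltW//= (lt_le_trans yd)// lerD2l /d !ge_min lexx orbT.
  move=> H; have FGy : F y = G y.
    by apply: H; rewrite /= in_itv/= yb andbT (le_trans ax)// ltW.
  have := H1 y yd1 yb; have := H2 y yd2 yb; rewrite FGy => h1 h2.
  have : `|F x - G x| < `|F x - G x| / 2 + `|F x - G x| / 2.
    have := ler_normD (- (G y - F x)) (G y - G x).
    have -> : - (G y - F x) + (G y - G x) = F x - G x by ring.
    by rewrite normrN => /le_lt_trans; apply; exact: ltrD.
  by rewrite -splitr ltxx.
have mI : measurable ([set` `]x, x + d[] : set (measurableTypeR R)).
  exact: measurable_itv.
have : mu [set` `]x, x + d[] = 0%E := measure_negligible mI N.
rewrite lebesgue_measure_itv/= lte_fin ltrDl d0 -EFinB addrAC subrr add0r => -[] d00.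
by rewrite d00 ltxx in d0.
Qed.

Lemma primitive_is_ac_derivative (h p : R -> R) c k :
  mu.-integrable setT (EFin \o p) ->
  (forall x, D x -> h x = c + k * primitive a p x) ->
  is_ac_derivative a b h (fun x => k * p x).
Proof.
move=> ip hE; split.
  apply: measurable_funM; first exact: measurable_cst.
  by apply: measurable_funTS; move/measurable_int : ip => /measurable_EFinP.
exists (fun x => c + k * primitive a p x); split.
- exact: primitive_ac.
- by apply/aeW => x Dx; rewrite hE.
- have na : \forall x \ae mu, x != a.
    rewrite /prop_near1/= /nbhs/= /almost_everywhere/=.
    exists [set a]; split; [exact: measurable_set1|exact: lebesgue_measure_set1|].
    by move=> x /= /negP; rewrite negbK => /eqP.
  have := primitive_is_derive a ip; move: na.
  apply: (@filterS2 _ _ (ae_filter_ringOfSetsType mu)) => x xa H.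
  rewrite in_itv/= => /andP[ax _].
  have {}ax : a < x by rewrite lt_neqAle eq_sym xa.
  have dP := H ax.
  have -> : k * p x = 0 + k *: p x by rewrite add0r.
  by apply: is_deriveD.
Qed.

(** Any absolutely continuous representative agrees with the explicit primitive on [a, b[, hence
    near every interior point, so the two have the same derivative there. *)
Lemma is_ac_derivative_ae (h p d : R -> R) c k :
  mu.-integrable setT (EFin \o p) ->
  (forall x, D x -> h x = c + k * primitive a p x) ->
  is_ac_derivative a b h d ->
  d = (fun x => k * p x) %[ae mu in D].
Proof.
move=> ip hE [md [F [acF FE dF]]].
pose G x := c + k * primitive a p x.
have FG : F = G %[ae mu in D].
  by move: FE; apply: (@filterS _ _ (ae_filter_ringOfSetsType mu)) => x H Dx; rewrite H// hE.
have FGE := abs_continuous_ae_eq acF (@primitive_ac _ a b _ c k ip) FG.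
(* The endpoints are discarded because [is_derive] is two-sided and F is unknown outside [a, b]. *)
have na : \forall x \ae mu, x != a.
  exists [set a]; split; [exact: measurable_set1|exact: lebesgue_measure_set1|].
  by move=> x /= /negP; rewrite negbK => /eqP.
have nb : \forall x \ae mu, x != b.
  exists [set b]; split; [exact: measurable_set1|exact: lebesgue_measure_set1|].
  by move=> x /= /negP; rewrite negbK => /eqP.
have dG : \forall x \ae mu, a < x -> is_derive x (1 : R) G (k * p x).
  have := primitive_is_derive a ip.
  apply: (@filterS _ _ (ae_filter_ringOfSetsType mu)) => x H ax; have dP := H ax.
  have -> : k * p x = 0 + k *: p x by rewrite add0r.
  by apply: is_deriveD.
have na_nb := @filterI _ _ (ae_filter_ringOfSetsType mu) _ _ na nb.
have dFG := @filterI _ _ (ae_filter_ringOfSetsType mu) _ _ dF dG.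
move: na_nb dFG; apply: (@filterS2 _ _ (ae_filter_ringOfSetsType mu)) => x [xa xb] [HF HG].
rewrite /= in_itv/= => /andP[ax xb'].
have {}xa : a < x by rewrite lt_neqAle eq_sym xa.
have {}xb : x < b by rewrite lt_neqAle xb.
have dFx : is_derive x (1 : R) F (d x) by apply: HF; rewrite in_itv/= ax.
have dGx := HG xa.
have nFG : \near x, F x = G x.
  have : \forall y \near x, y \in `]a, b[.
    by apply: near_in_itvoo; rewrite in_itv/= xa.
  apply: filterS => y; rewrite in_itv/= => /andP[ay yb].
  by apply: FGE; rewrite ltW.
have dFx' := near_eq_is_derive nFG dFx.
by rewrite -(@derive_val _ _ _ _ _ _ _ dGx) -(@derive_val _ _ _ _ _ _ _ dFx').
Qed.

End ac_derivative.

(** * The fractional operators *)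

Section bounded_representatives.
Context {R : realType} (a b : R).
Local Notation mu := (@lebesgue_measure R).
Local Notation D := ([set` `[a, b]] : set R).
Implicit Types (phi g : R -> R).

Lemma restrict_integrable phi : mu.-integrable D (EFin \o phi) <->
  mu.-integrable setT (EFin \o (phi \_ D)).
Proof. by rewrite -restrict_EFin; apply: integrable_mkcond; exact: measurable_itv. Qed.

Lemma Lp_itv1P phi : Lp_itv a b 1%E phi <-> mu.-integrable D (EFin \o phi).
Proof. by rewrite restrict_integrable; exact: Lfun1_integrable. Qed.

Lemma Lp_itvy_bounded phi : Lp_itv a b +oo%E phi ->
  measurable_fun D phi /\
  exists M, \forall t \ae mu, D t -> `|phi t| <= M.
Proof.
rewrite /Lp_itv/= inE => /andP[/[!inE]/= mphi].
(* The L^oo norm is an essential supremum only when the whole space has positive measure; [0, 1]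
   witnesses this. *)
rewrite /finite_norm unlock /Lnorm ifT; last first.
  have : (mu [set` `[0%R, 1%R]] <= mu setT)%E.
    by apply: le_measure; rewrite ?inE//; exact: measurable_itv.
  by apply: lt_le_trans; rewrite lebesgue_measure_itv/= lte_fin ltr01 oppr0 adde0 lte_fin.
move=> /ess_supr_bounded[M HM]; split.
  by apply/(measurable_restrictT _ _).2 => //; exact: measurable_itv.
exists M; move: HM; apply: (@filterS _ _ (ae_filter_ringOfSetsType mu)) => t /= + Dt.
by rewrite patchE mem_set.
Qed.

Lemma bounded_integrable phi M : measurable_fun D phi ->
  (\forall t \ae mu, D t -> `|phi t| <= M) -> mu.-integrable D (EFin \o phi).
Proof.
move=> mphi HM; apply/integrableP; split; first exact/measurable_EFinP.
apply: (@le_lt_trans _ _ (\int[mu]_(t in D) (Num.max M 0)%:E)%E).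
  apply: ae_ge0_le_integral => //.
  - by apply: measurableT_comp => //; exact/measurable_EFinP.
  - by move=> t _; rewrite lee_fin le_max lexx orbT.
  - move: HM; apply: (@filterS _ _ (ae_filter_ringOfSetsType mu)) => t H Dt.
    by rewrite /= lee_fin le_max H.
have muD : (mu D < +oo)%E.
  by rewrite lebesgue_measure_itv/= lte_fin; case: ifPn => // _; rewrite -EFinB ltry.
rewrite integral_cst; last exact: measurable_itv.
by apply: lte_mul_pinfty => //; rewrite lee_fin le_max lexx orbT.
Qed.

(** Nothing is asked of w at t = x, where the kernel has a junk value: passing to the half-open
    interval drops that point. *)
Lemma kernel_op_left K (w : R -> R) g x : measurable_fun setT K ->
  measurable_fun D g -> x \in `[a, b] ->
  (forall t, t \in `[a, b] -> t < x -> w t = fine (K (x - t))) ->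
  (forall t, t \in `[a, b] -> x <= t -> K (x - t) = 0%E) ->
  \int[mu]_(t in `[a, x]) (w t * g t) = kernel_op a b K g x.
Proof.
move=> mK mg; rewrite in_itv/= => /andP[ax xb] w1 w0.
have sub t : t \in `[a, x[ -> t \in `[a, b].
  by rewrite !in_itv/= => /andP[-> /ltW tx]; rewrite (le_trans tx).
have mKg : measurable_fun `[a, x[ (fun t => (fine (K (x - t)) * g t)%:E).
  apply/measurable_EFinP; apply: measurable_funM; last first.
    by apply: measurable_funS mg => //; exact: measurable_itv.
  apply: measurable_funTS; apply: measurableT_comp => //.
  by apply: (measurableT_comp mK); exact: measurable_funB.
have E t : t \in `[a, x[ -> (w t * g t)%:E = (fine (K (x - t)) * g t)%:E.
  move=> tx; rewrite w1//; first exact: sub.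
  by move: tx; rewrite in_itv/= => /andP[].
rewrite /kernel_op /Rintegral; congr fine.
rewrite -integral_itv_bndo_bndc; last first.
  apply: eq_measurable_fun mKg => t /set_mem tx; exact/esym/E.
rewrite [LHS]integral_mkcond [RHS]integral_mkcond; apply: eq_integral => t _.
rewrite !patchE; case: ifPn => tx.
  rewrite ifT ?E//; move: tx; rewrite !inE//=; exact: sub.
case: ifPn => // tD; rewrite w0 ?mul0r//; first by move: tD; rewrite inE.
rewrite leNgt; apply: contra tx => tx; move: tD; rewrite !inE/= !in_itv/=.
by move=> /andP[-> _].
Qed.

Lemma kernel_op_right K (w : R -> R) g x : measurable_fun setT K ->
  measurable_fun D g -> x \in `[a, b] ->
  (forall t, t \in `[a, b] -> x < t -> w t = fine (K (x - t))) ->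
  (forall t, t \in `[a, b] -> t <= x -> K (x - t) = 0%E) ->
  \int[mu]_(t in `[x, b]) (w t * g t) = kernel_op a b K g x.
Proof.
move=> mK mg; rewrite in_itv/= => /andP[ax xb] w1 w0.
have sub t : t \in `]x, b] -> t \in `[a, b].
  by rewrite !in_itv/= => /andP[/ltW xt ->]; rewrite (le_trans ax).
have mKg : measurable_fun `]x, b] (fun t => (fine (K (x - t)) * g t)%:E).
  apply/measurable_EFinP; apply: measurable_funM; last first.
    by apply: measurable_funS mg => //; exact: measurable_itv.
  apply: measurable_funTS; apply: measurableT_comp => //.
  by apply: (measurableT_comp mK); exact: measurable_funB.
have E t : t \in `]x, b] -> (w t * g t)%:E = (fine (K (x - t)) * g t)%:E.
  move=> tx; rewrite w1//; first exact: sub.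
  by move: tx; rewrite in_itv/= => /andP[].
rewrite /kernel_op /Rintegral; congr fine.
rewrite -integral_itv_obnd_cbnd; last first.
  apply: eq_measurable_fun mKg => t /set_mem tx; exact/esym/E.
rewrite [LHS]integral_mkcond [RHS]integral_mkcond; apply: eq_integral => t _.
rewrite !patchE; case: ifPn => tx.
  rewrite ifT ?E//; move: tx; rewrite !inE//=; exact: sub.
case: ifPn => // tD; rewrite w0 ?mul0r//; first by move: tD; rewrite inE.
rewrite leNgt; apply: contra tx => tx; move: tD; rewrite !inE/= !in_itv/=.
by move=> /andP[_ ->]; rewrite tx.
Qed.

Lemma Rintegral_restrict_itv phi (x : R) : x \in `[a, b] ->
  \int[mu]_(t in `[a, x]) phi t = primitive a (phi \_ D) x.
Proof.
rewrite in_itv/= => /andP[_ xb]; apply: eq_Rintegral => t.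
rewrite inE/= in_itv/= => /andP[at_ tx].
by rewrite patchE mem_set//= in_itv/= at_ (le_trans tx).
Qed.

End bounded_representatives.

Section fractional_kernels.
Context {R : realType}.
Local Notation mu := (@lebesgue_measure R).
Implicit Types (s x c : R).

(* s = 1 / alpha gives the left-sided kernels and s = - 1 / alpha the
   right-sided ones. *)
Definition expint_kernel s x : \bar R := upper_gamma 0 (x * s).

Definition volterra_kernel s x : \bar R := volterra (x * s).

Lemma measurable_expint_kernel s : measurable_fun setT (expint_kernel s).
Proof. exact: measurable_rescale (@measurable_upper_gamma R 0). Qed.

Lemma measurable_volterra_kernel s : measurable_fun setT (volterra_kernel s).
Proof. exact: measurable_rescale (@measurable_volterra R). Qed.

Lemma expint_kernel_ge0 s x : (0 <= expint_kernel s x)%E.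
Proof. exact: upper_gamma_ge0. Qed.

Lemma volterra_kernel_ge0 s x : (0 <= volterra_kernel s x)%E.
Proof. exact: volterra_ge0. Qed.

Lemma volterra_kernelN s : volterra_kernel s \o -%R = volterra_kernel (- s).
Proof. by apply/funext => x; rewrite /volterra_kernel /= mulNr mulrN. Qed.

Lemma expint_kernel_le0 s x : x * s <= 0 -> expint_kernel s x = 0%E.
Proof. by rewrite /expint_kernel /upper_gamma ltNge => ->. Qed.

Lemma volterra_kernel_le0 s x : x * s <= 0 -> volterra_kernel s x = 0%E.
Proof. exact: volterra_le0. Qed.

Lemma conv_expint_volterra s x : s != 0 ->
  conv (expint_kernel s) (volterra_kernel s) x =
  (`|s^-1|%:E * heaviside (x * s))%E.
Proof.
move=> s0; rewrite -sonine; apply: conv_rescale => //.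
- exact: measurable_upper_gamma.
- exact: measurable_volterra.
- exact: upper_gamma_ge0.
- exact: volterra_ge0.
Qed.

Lemma conv_expint_volterra_le s x : s != 0 ->
  (conv (expint_kernel s) (volterra_kernel s) x <= `|s^-1|%:E)%E.
Proof.
move=> s0; rewrite conv_expint_volterra// /heaviside.
by case: ifPn => _; rewrite ?mule1 ?mule0 ?lee_fin.
Qed.

Lemma volterra_kernel_loc s c : s != 0 ->
  (\int[mu]_t (if ((t : R) \in `[- c, c])%R then volterra_kernel s t else 0) < +oo)%E.
Proof.
(* For t in [- c, c], s t <= c |s|; the added 1 makes this strict, as the half-line y < M
   requires. *)
move=> s0; pose M := c * `|s| + 1.
pose G y : \bar R := if y < M then volterra y else 0%E.
have mG : measurable_fun setT G.
  by apply: measurable_if_ltr => //; exact: measurable_volterra.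
have G0 y : (0 <= G y)%E by rewrite /G; case: ifPn => // _; exact: volterra_ge0.
have mGs : measurable_fun setT (fun t : R => G (s * t + 0)).
  by apply: (measurableT_comp mG); apply: measurable_funD => //; exact: measurable_funM.
apply: (@le_lt_trans _ _ (\int[mu]_t G (s * t + 0)%R)%E); last first.
  rewrite ge0_integral_affine//; apply: lte_mul_pinfty => //.
  by rewrite -conv_heavisideE; exact: conv_heaviside_volterra_lty.
apply: ge0_le_integral => //.
- by move=> t _; case: ifPn => // _; exact: volterra_kernel_ge0.
- rewrite (_ : (fun _ => _) = volterra_kernel s \_ [set` `[- c, c]]); last first.
    by apply/funext => t; rewrite patchE mem_setE.
  apply/(measurable_restrictT _ _).1; first exact: measurable_itv.
  by apply: measurable_funTS; exact: measurable_volterra_kernel.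
- move=> t _; case: ifPn => // tc; rewrite addr0 /G mulrC ifT//.
  rewrite /M ltr_pwDr// (le_trans (ler_norm _))// normrM ler_wpM2r//.
  by rewrite ler_norml; move: tc; rewrite in_itv.
Qed.

Variables (alpha a b : R).
Hypotheses (alpha0 : 0 < alpha) (ab : a < b).
Local Notation D := ([set` `[a, b]] : set R).
Implicit Types (f g phi psi : R -> R).

Let V := volterra_kernel alpha^-1.
Let E := expint_kernel alpha^-1.
Let VN := volterra_kernel (- alpha^-1).
Let EN := expint_kernel (- alpha^-1).

Let va0 : 0 < alpha^-1. Proof. by rewrite invr_gt0. Qed.
Let v0 : alpha^-1 != 0. Proof. by rewrite gt_eqF. Qed.
Let vN0 : - alpha^-1 != 0. Proof. by rewrite oppr_eq0. Qed.

Lemma Sleft_kernel_op phi x : measurable_fun D phi -> x \in `[a, b] ->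
  Sleft alpha a phi x = kernel_op a b V phi x.
Proof.
move=> mphi xD; apply: kernel_op_left => //.
- exact: measurable_volterra_kernel.
- by move=> t _ tx; rewrite SkernelE// divr_gt0// subr_gt0.
- by move=> t _ xt; rewrite /V /VN volterra_kernel_le0// pmulr_lle0// subr_le0.
Qed.

Lemma Sright_kernel_op psi x : measurable_fun D psi -> x \in `[a, b] ->
  Sright alpha b psi x = kernel_op a b VN psi x.
Proof.
move=> mpsi xD; apply: kernel_op_right => //.
- exact: measurable_volterra_kernel.
- move=> t _ xt; rewrite SkernelE; last by rewrite divr_gt0// subr_gt0.
  by rewrite /VN /volterra_kernel mulrN -mulNr opprB.
- by move=> t _ tx; rewrite /V /VN volterra_kernel_le0// mulrN oppr_le0 mulr_ge0 ?subr_ge0 ?(ltW va0).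
Qed.

Lemma Jleft_kernel_op g x : measurable_fun D g -> x \in `[a, b] ->
  Jleft alpha a g x = alpha^-1 * kernel_op a b E g x.
Proof.
move=> mg xD; congr (_ * _); apply: kernel_op_left => //.
- exact: measurable_expint_kernel.
- by move=> t _ tx; rewrite expint1E// divr_gt0// subr_gt0.
- by move=> t _ xt; rewrite /E /EN expint_kernel_le0// pmulr_lle0// subr_le0.
Qed.

Lemma Jright_kernel_op f x : measurable_fun D f -> x \in `[a, b] ->
  Jright alpha b f x = alpha^-1 * kernel_op a b EN f x.
Proof.
move=> mf xD; congr (_ * _); apply: kernel_op_right => //.
- exact: measurable_expint_kernel.
- move=> t _ xt; rewrite expint1E; last by rewrite divr_gt0// subr_gt0.
  by rewrite /EN /expint_kernel mulrN -mulNr opprB.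
- by move=> t _ tx; rewrite /E /EN expint_kernel_le0// mulrN oppr_le0 mulr_ge0 ?subr_ge0 ?(ltW va0).
Qed.

Let measurable_D phi : mu.-integrable D (EFin \o phi) -> measurable_fun D phi.
Proof. by move/measurable_int => /measurable_EFinP. Qed.

Let mC s : measurable_fun setT (conv (expint_kernel s) (volterra_kernel s)).
Proof.
apply: measurable_conv; [exact: measurable_expint_kernel| |
  exact: expint_kernel_ge0|exact: volterra_kernel_ge0].
exact: measurable_volterra_kernel.
Qed.

(** The form [0 + 1 * _] is an instance of [c + k * primitive], under which both sides share one
    differentiation lemma. *)
Lemma Jleft_Sleft phi g : mu.-integrable D (EFin \o phi) -> measurable_fun D g ->
  g = kernel_op a b V phi %[ae mu in D] ->
  forall x, D x -> Jleft alpha a g x = 0 + 1 * primitive a (phi \_ D) x.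
Proof.
move=> iphi mg gE x xD; rewrite Jleft_kernel_op//.
rewrite (kernel_op_comp (measurable_expint_kernel _)
  (measurable_volterra_kernel _) (expint_kernel_ge0 _) (volterra_kernel_ge0 _)
  (fun c => volterra_kernel_loc c v0) iphi mg gE)//; last 2 first.
- move=> z t u; rewrite !in_itv/= negb_and -!ltNge.
  move=> /andP[_ zb] /orP[ta|bt] /andP[au _].
    by right; apply: volterra_kernel_le0; rewrite pmulr_lle0// subr_le0 (le_trans (ltW ta)).
  by left; apply: expint_kernel_le0; rewrite pmulr_lle0// subr_le0 (le_trans zb)// ltW.
- by exists `|alpha^-1^-1| => y; exact: conv_expint_volterra_le.
(* By the rescaled Sonine identity the composed kernel is the constant alpha on t < x, and it
   cancels the factor 1 / alpha of J. *)
rewrite -(@kernel_op_left _ a b _ (cst alpha))//; last 3 first.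
- exact: measurable_D.
- move=> t _ tx; rewrite conv_expint_volterra// /heaviside pmulr_lgt0// subr_gt0 tx.
  by rewrite mule1 invrK gtr0_norm.
- move=> t _ xt; rewrite conv_expint_volterra// /heaviside pmulr_lgt0// subr_gt0.
  by rewrite ltNge xt mule0.
have xD' : x \in `[a, b] by [].
have ix : mu.-integrable `[a, x] (EFin \o phi).
  apply: integrableS iphi => //; try exact: measurable_itv.
  move=> t /=; move: xD'; rewrite !in_itv/= => /andP[_ xb] /andP[-> tx].
  exact: le_trans xb.
rewrite RintegralZl; [|exact: measurable_itv|by []].
by rewrite mulrA mulVf ?gt_eqF// add0r !mul1r (Rintegral_restrict_itv phi xD').
Qed.

(** The integral over [x, b] is the one over [a, b] minus the one over [a, x]; hence the constant
    [primitive _ b] and the slope -1, the source of the minus sign in the theorem. *)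
Lemma Jright_Sright psi f : mu.-integrable D (EFin \o psi) -> measurable_fun D f ->
  f = kernel_op a b VN psi %[ae mu in D] ->
  forall x, D x -> Jright alpha b f x =
    primitive a (psi \_ D) b + (-1) * primitive a (psi \_ D) x.
Proof.
move=> ipsi mf fE x xD; rewrite Jright_kernel_op//.
rewrite (kernel_op_comp (measurable_expint_kernel _)
  (measurable_volterra_kernel _) (expint_kernel_ge0 _) (volterra_kernel_ge0 _)
  (fun c => volterra_kernel_loc c vN0) ipsi mf fE)//; last 2 first.
- move=> z t u; rewrite !in_itv/= negb_and -!ltNge.
  move=> /andP[az _] /orP[ta|bt] /andP[_ ub].
    left; apply: expint_kernel_le0.
    by rewrite mulrN oppr_le0 mulr_ge0 ?(ltW va0)// subr_ge0 (le_trans (ltW ta)).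
  right; apply: volterra_kernel_le0.
  by rewrite mulrN oppr_le0 mulr_ge0 ?(ltW va0)// subr_ge0 (le_trans ub)// ltW.
- by exists `|(- alpha^-1)^-1| => y; exact: conv_expint_volterra_le.
rewrite -(@kernel_op_right _ a b _ (cst alpha))//; last 3 first.
- exact: measurable_D.
- move=> t _ xt; rewrite conv_expint_volterra// /heaviside mulrN -mulNr opprB.
  by rewrite pmulr_lgt0// subr_gt0 xt mule1 invrN invrK normrN gtr0_norm.
- move=> t _ tx; rewrite conv_expint_volterra// /heaviside mulrN -mulNr opprB.
  by rewrite pmulr_lgt0// subr_gt0 ltNge tx mule0.
have xD' : x \in `[a, b] by [].
have ix : mu.-integrable `]x, b] (EFin \o psi).
  apply: integrableS ipsi => //; try exact: measurable_itv.
  move=> t /=; move: xD'; rewrite !in_itv/= => /andP[ax _] /andP[xt ->].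
  by rewrite andbT (le_trans ax)// ltW.
have ix' : mu.-integrable `[x, b] (EFin \o psi).
  apply: integrableS ipsi => //; try exact: measurable_itv.
  move=> t /=; move: xD'; rewrite !in_itv/= => /andP[ax _] /andP[xt ->].
  by rewrite andbT (le_trans ax).
rewrite RintegralZl; [|exact: measurable_itv|by []].
rewrite mulrA mulVf ?gt_eqF// mul1r mulN1r.
have bD : b \in `[a, b] by rewrite in_itv/= lexx ltW.
rewrite -(Rintegral_restrict_itv psi xD') -(Rintegral_restrict_itv psi bD).
have /andP[ax xb] : a <= x <= b by move: xD'; rewrite in_itv.
have -> : \int[mu]_(t in `[a, b]) psi t - \int[mu]_(t in `[a, x]) psi t =
    \int[mu]_(t in `]x, b]) psi t.
  by apply: Rintegral_itvB => //; rewrite bnd_simp.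
exact/esym/Rintegral_itv_obnd_cbnd.
Qed.

End fractional_kernels.

(** Real integrals are total, so an equality alone might compare junk values: existence of both
    derivatives and integrability of both products are therefore asserted too, and the formula is
    claimed for every choice of representatives of the derivatives. *)
Theorem theorem4p12 (R : realType) (alpha a b : R) (f g : R -> R) :
  0 < alpha -> a < b ->
  Sright_space alpha a b +oo%E f ->
  Sleft_space alpha a b 1%E g ->
  [/\ exists dg : R -> R, is_left_fracderiv alpha a b g dg,
      exists df : R -> R, is_right_fracderiv alpha a b f df &
      forall dg df : R -> R,
        is_left_fracderiv alpha a b g dg ->
        is_right_fracderiv alpha a b f df ->
        [/\ (@lebesgue_measure R).-integrable `[a, b]
              (fun x => (f x * dg x)%:E),
            (@lebesgue_measure R).-integrable `[a, b]
              (fun x => (df x * g x)%:E) &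
            \int[@lebesgue_measure R]_(x in `[a, b]) (f x * dg x) =
            - \int[@lebesgue_measure R]_(x in `[a, b]) (df x * g x)]].
Proof.
move=> alpha0 ab [mf [psi psiL fE]] [mg [phi phiL gE]].
have iphi := (Lp_itv1P a b phi).1 phiL.
have [mpsi [M psiM]] := Lp_itvy_bounded psiL.
have ipsi := bounded_integrable mpsi psiM.
have mphi : measurable_fun `[a, b] phi.
  by move/measurable_int : iphi => /measurable_EFinP.
have sn0 : - alpha^-1 != 0 by rewrite oppr_eq0 gt_eqF// invr_gt0.
have s0 : alpha^-1 != 0 by rewrite gt_eqF// invr_gt0.
have aeF := ae_filter_ringOfSetsType (@lebesgue_measure R).
have {}gE : g = kernel_op a b (volterra_kernel alpha^-1) phi
    %[ae (@lebesgue_measure R) in [set` `[a, b]]].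
  move: gE; apply: (@filterS _ _ aeF) => x H Dx.
  by rewrite H// (Sleft_kernel_op alpha0 mphi).
have {}fE : f = kernel_op a b (volterra_kernel (- alpha^-1)) psi
    %[ae (@lebesgue_measure R) in [set` `[a, b]]].
  move: fE; apply: (@filterS _ _ aeF) => x H Dx.
  by rewrite H// (Sright_kernel_op alpha0 mpsi).
have Jg := Jleft_Sleft alpha0 iphi mg gE.
have Jf := Jright_Sright alpha0 ab ipsi mf fE.
have iphi' := (restrict_integrable a b phi).1 iphi.
have ipsi' := (restrict_integrable a b psi).1 ipsi.
have ig := kernel_op_range_integrable (measurable_volterra_kernel _)
  (volterra_kernel_ge0 _) (fun c => volterra_kernel_loc c s0) iphi mg gE.
have if_ := kernel_op_range_integrable (measurable_volterra_kernel _)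
  (volterra_kernel_ge0 _) (fun c => volterra_kernel_loc c sn0) ipsi mf fE.
split.
- exists (fun x => 1 * (phi \_ `[a, b]) x); split; first exact/Lp_itv1P.
  exact: primitive_is_ac_derivative iphi' Jg.
- exists (fun x => -1 * (psi \_ `[a, b]) x); split; first exact/Lp_itv1P.
  exact: primitive_is_ac_derivative ipsi' Jf.
move=> dg df [_ dgP] [_ dfP].
have mdg := dgP.1; have mdf := dfP.1.
have dgE := is_ac_derivative_ae iphi' Jg dgP.
have dfE := is_ac_derivative_ae ipsi' Jf dfP.
have fVN : f = kernel_op a b (volterra_kernel alpha^-1 \o -%R) psi
    %[ae (@lebesgue_measure R) in [set` `[a, b]]].
  by rewrite volterra_kernelN.
have [i1 i2 E] := kernel_op_dual (measurable_volterra_kernel _)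
  (volterra_kernel_ge0 _) (fun c => volterra_kernel_loc c s0) iphi ipsi psiM
  mf mg fVN gE.
have mD : measurable ([set` `[a, b]] : set (measurableTypeR R)).
  exact: measurable_itv.
have ae1 : ae_eq (@lebesgue_measure R) [set` `[a, b]] (fun x => (phi x * f x)%:E)
    (fun x => (f x * dg x)%:E).
  move: dgE; apply: (@filterS _ _ aeF) => x H Dx.
  by rewrite H// mul1r patchE mem_set// mulrC.
have ae2 : ae_eq (@lebesgue_measure R) [set` `[a, b]] (fun x => (-1 * (psi x * g x))%:E)
    (fun x => (df x * g x)%:E).
  move: dfE; apply: (@filterS _ _ aeF) => x H Dx.
  by rewrite H// patchE mem_set// mulrA.
have m1 : measurable_fun `[a, b] (fun x => (f x * dg x)%:E).
  by apply/measurable_EFinP; exact: measurable_funM.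
have m2 : measurable_fun `[a, b] (fun x => (df x * g x)%:E).
  by apply/measurable_EFinP; exact: measurable_funM.
have i2N : (@lebesgue_measure R).-integrable `[a, b]
    (fun x => (-1 * (psi x * g x))%:E) := integrableZl mD (-1) i2.
have [j1 e1] := ae_eq_integrable mD m1 i1 ae1.
have [j2 e2] := ae_eq_integrable mD m2 i2N ae2.
split => //.
transitivity (\int[@lebesgue_measure R]_(x in `[a, b]) (phi x * f x)).
  by rewrite /Rintegral -e1.
rewrite E -[LHS]opprK -[X in - X]mulN1r -(RintegralZl (-1) mD i2).
by rewrite /Rintegral e2.
Qed.
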